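(* There exists $\ell_0\in\mathbb N$ such that for all $\ell>\ell_0$, $\mathrm{ex}(n,T^{\ell}_{4,7})=\Theta(n^{10/7})$.
   Context: $\mathrm{ex}(n,F)$ is the maximum number of edges in an $n$-vertex graph with no subgraph isomorphic to $F$. $T_{4,7}$ is the rooted tree obtained from a path $v_1v_2v_3v_4$ by attaching one new pendant leaf $r_i$ to each $v_i$ ($i=1,\dots,4$); it is rooted on $\{r_1,r_2,r_3,r_4\}$ (so it has $4$ non-root vertices and $7$ edges). For $\ell\in\mathbb N$, $T^\ell_{4,7}$ is the blow-up obtained from $\ell$ vertex-disjoint copies of $T_{4,7}$ by identifying, for each root $r_i$, the $\ell$ copies of $r_i$ into one vertex. *)

(* Defs.v *)
From mathcomp Require Import all_boot.
Set Implicit Arguments. Unset Strict Implicit. Unset Printing Implicit Defensive.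

(* A simple graph on vertex set 'I_n is encoded by a set E of ordered pairs;
   x,y are adjacent iff x <> y and (x,y) or (y,x) is in E.  Every simple graph
   on 'I_n arises this way. *)
Definition adj (n : nat) (E : {set 'I_n * 'I_n}) (x y : 'I_n) : bool :=
  (x != y) && (((x, y) \in E) || ((y, x) \in E)).

Definition num_edges (n : nat) (E : {set 'I_n * 'I_n}) : nat :=
  #|[set p : 'I_n * 'I_n | (p.1 < p.2)%N && adj E p.1 p.2]|.

Definition contains (n : nat) (E : {set 'I_n * 'I_n}) (V : finType) (F : rel V) : bool :=
  [exists f : {ffun V -> 'I_n},
     injectiveb f && [forall x, forall y, F x y ==> adj E (f x) (f y)]].

Definition ex (n : nat) (V : finType) (F : rel V) : nat :=
  \max_(E : {set 'I_n * 'I_n} | ~~ contains E F) num_edges E.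

(* The blow-up T^l_{4,7}: vertices are the 4 roots r_i (inl i) and, for each
   copy j < l, the path vertices v_i^j (inr (j, i)), i < 4.
   Edges: r_i -- v_i^j, and v_i^j -- v_{i+1}^j. *)
Definition Tblowup_V (l : nat) : finType := ('I_4 + ('I_l * 'I_4))%type.

Definition Tblowup (l : nat) : rel (Tblowup_V l) :=
  fun x y =>
    match x, y with
    | inl i, inr (_, k) => i == k
    | inr (_, k), inl i => i == k
    | inr (j, k), inr (j', k') =>
        (j == j') && ((k.+1 == k' :> nat) || (k'.+1 == k :> nat))
    | _, _ => false
    end.

(* Main.v *)
Require Import Defs.
From Stdlib Require Import Reals Lra.
From HB Require structures.
From mathcomp Require Import ssreflect ssrbool.
From mathcomp Require all_boot all_algebra all_field zify ring mpoly.

(* Upper bound. A denser small subset can be iterated away, so one may assume that the graph is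
   almost regular of degree about [C n^(3/7)]. Call a pair heavy if its codegree is at least a
   large constant [t]. Few 2-paths have heavy ends, for otherwise T^l is found greedily; hence
   most of the [>= c C^7 n^4] copies of T are light, and some root tuple carries many of them.
   Fixing the roots and one path vertex of a light copy leaves at most [t^3] copies, so [l]
   disjoint ones can be chosen greedily.

   Lower bound. Take two copies of F_q^7 as vertex classes and join x to y when four random
   polynomials of bounded degree vanish at (x, y). Fix the four roots. The copies of T on them
   are the zeros of a system of 28 polynomials in 28 unknowns. Boundedly many zeros have a
   nonsingular Jacobian (Wooley's elementary form of Bezout's theorem). A singular zero costs an
   extra factor O(1/q): its Jacobian has at least q kernel vectors, and since T is balanced the
   expected number of pairs (zero, kernel vector) is bounded per root tuple. Values and
   directional derivatives of the random polynomials at distinct points being independent,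
   33 disjoint singular copies on a common root tuple occur with expected number less than 1.
   This replaces the Lang-Weil estimate of the usual random algebraic construction. *)

Module CombBlowup.
Import all_boot zify.
Local Open Scope nat_scope.
Set Implicit Arguments. Unset Strict Implicit. Unset Printing Implicit Defensive.

(** * Counting *)

Lemma double_counting (T U : finType) (A : {pred T}) (B : {pred U}) (R : T -> U -> bool) :
  \sum_(a in A) #|[set b in B | R a b]| = \sum_(b in B) #|[set a in A | R a b]|.
Proof.
under eq_bigr do rewrite -sum1_card.
under [RHS]eq_bigr do rewrite -sum1_card.
rewrite (exchange_big_dep (mem B)) /=; last by move=> a b _; rewrite inE => /andP[].
by apply: eq_bigr => b bB; apply: eq_bigl => a; rewrite !inE; apply/andb_id2l; rewrite bB.
Qed.

Lemma expn_card_gt0 (T : finType) (x : T) n : 0 < #|T| ^ n.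
Proof. by rewrite expn_gt0; apply/orP; left; apply/card_gt0P; exists x. Qed.

Lemma card_set_pair (T U : finType) (A : {pred T}) (R : T -> U -> bool) :
  #|[set p : T * U | (p.1 \in A) && R p.1 p.2]| = \sum_(a in A) #|[set b | R a b]|.
Proof.
under [RHS]eq_bigr do rewrite -sum1_card.
rewrite pair_big_dep /= -sum1_card; apply: eq_bigl => -[a b].
by rewrite !inE.
Qed.

Lemma markov_card (T : finType) (A : {pred T}) (f : T -> nat) c :
  #|[set x in A | c < f x]| * c <= \sum_(x in A) f x.
Proof.
rewrite -sum_nat_const (bigID (fun x => c < f x) (mem A)) /=.
apply: leq_trans (leq_addr _ _); rewrite [leqLHS](eq_bigl [pred x | x \in A & c < f x]).
  by apply: leq_sum => x /andP[_ /ltnW].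
by move=> x; rewrite !inE.
Qed.

Lemma exists_leq_of_sum (T : finType) (A : {set T}) (f g : T -> nat) :
  A != set0 -> \sum_(x in A) f x <= \sum_(x in A) g x -> exists2 x, x \in A & f x <= g x.
Proof.
case/set0Pn=> x0 x0A le_sum; apply/exists_inP; move: le_sum; apply: contraTT.
rewrite negb_exists_in -ltnNge => /forall_inP gt_f.
have lt_gf x : x \in A -> g x < f x by move/gt_f; rewrite -ltnNge.
rewrite (bigD1 x0) //= [ltnRHS](bigD1 x0) //= -addSn.
by apply: leq_add; [exact: lt_gf | apply: leq_sum => x /andP[/lt_gf/ltnW]].
Qed.

Lemma card_bigcup_le (I T : finType) (A : {pred I}) (F : I -> {set T}) n :
  {in A, forall i, #|F i| <= n} -> #|\bigcup_(i in A) F i| <= #|A| * n.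
Proof.
move=> leF; rewrite -sum_nat_const.
elim/big_ind2: _ => [|S m S' m' leS leS'|i /leF//]; first by rewrite cards0.
by apply: leq_trans (leq_card_setU _ _).1 (leq_add leS leS').
Qed.

Lemma leq_card_fibers (T U : finType) (A : {set T}) (B : {set U}) (g : T -> U) m :
  {in A, forall x, g x \in B} -> (forall y, #|[set x in A | g x == y]| <= m) ->
  #|A| <= #|B| * m.
Proof.
move=> gB fiber_le; rewrite -sum_nat_const -sum1_card (partition_big g (mem B)) //=.
apply: leq_sum => y _; apply: leq_trans (fiber_le y).
by rewrite sum1dep_card; apply/eq_leq/eq_card => x; rewrite !inE.
Qed.

Lemma exists_avoiding (T : finType) (A X : {set T}) (s : seq T) :
  #|X| + size s < #|A| -> exists x, [/\ x \in A, x \notin X & x \notin s].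
Proof.
move=> lt_A; suff /subsetPn[x xA] : ~~ (A \subset X :|: [set y in s]).
  by rewrite !inE negb_or => /andP[xX xs]; exists x.
apply: contraL lt_A => /subset_leq_card leA; rewrite -leqNgt; apply: leq_trans leA _.
by apply: leq_trans (leq_card_setU _ _).1 _; rewrite leq_add2l cardsE card_size.
Qed.

Lemma exists_heaviest_subset (T : finType) (f : T -> nat) (S : {set T}) b : b <= #|S| ->
  exists B : {set T}, [/\ B \subset S, #|B| = b &
    b * \sum_(x in S) f x <= #|S| * \sum_(x in B) f x].
Proof.
have [n] := ubnP #|S|; elim: n S => // n IHn S; rewrite ltnS => leSn.
rewrite leq_eqVlt => /predU1P[->|lt_bS]; first by exists S.
have /card_gt0P[x0 x0S] : 0 < #|S| by lia.
case: (arg_minnP f x0S) => x /= xS x_min.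
have cardS : #|S| = #|S :\ x|.+1 by rewrite (cardsD1 x) [x \in S]xS.
have [||B [BS cardB le_sumB]] := IHn (S :\ x); try lia.
exists B; split=> //; first by apply: subset_trans BS (subsetDl _ _).
have x_light : #|S :\ x| * f x <= \sum_(y in S :\ x) f y.
  by rewrite -sum_nat_const; apply: leq_sum => y /setD1P[_ /x_min].
rewrite (big_setD1 x xS) /=; move: le_sumB x_light cardS.
set m := #|S :\ x|; set F := \sum_(y in S :\ x) f y; set G := \sum_(y in B) f y.
move=> le_sumB x_light cardS; rewrite cardS.
have [m0|m0] := posnP m; first by have -> : b = 0 by lia.
by rewrite -(leq_pmul2l m0); apply: (@leq_trans (m.+1 * (b * F))); nia.
Qed.

Lemma card_set_tuple_on (T : finType) (A : {set T}) k :
  #|[set s : k.-tuple T | all (mem A) s]| = #|A| ^ k.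
Proof.
pose f (s : k.-tuple T) := [ffun i => tnth s i].
have f_inj : injective f.
  by move=> s s' /ffunP eq_f; apply: eq_from_tnth => i; have := eq_f i; rewrite !ffunE.
rewrite -[k in RHS]card_ord -card_ffun_on -(card_imset _ f_inj); apply: eq_card => g.
apply/imsetP/ffun_onP => [[s + ->] i|gA].
  by rewrite inE ffunE => /allP; apply; exact: mem_tnth.
exists [tuple g i | i < k]; last by apply/ffunP => i; rewrite ffunE tnth_mktuple.
by rewrite inE; apply/allP => _ /tnthP[i ->]; rewrite tnth_mktuple; exact: gA.
Qed.

Lemma card_tuple_extend_ge (T : finType) (P : pred (seq T)) (m : nat -> nat) k :
  P [::] -> (forall s, size s < k -> P s -> m (size s) <= #|[set x | P (rcons s x)]|) ->
  \prod_(i < k) m i <= #|[set s : k.-tuple T | P s]|.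
Proof.
move=> P0; elim: k => [_|k IHk ext_ge].
  by rewrite big_ord0; apply/card_gt0P; exists [tuple]; rewrite inE.
rewrite big_ord_recr /=.
apply: (@leq_trans (\sum_(s in [set s : k.-tuple T | P s]) m k)).
  rewrite sum_nat_const leq_mul2r; apply/orP; right; apply: IHk => s lt_sk.
  by apply: ext_ge; exact: ltnW.
apply: (@leq_trans (\sum_(s in [set s : k.-tuple T | P s]) #|[set x | P (rcons s x)]|)).
  apply: leq_sum => s; rewrite inE => Ps; rewrite -[k in m k](size_tuple s).
  by apply: ext_ge => //; rewrite size_tuple.
rewrite -(card_set_pair (mem [set s : k.-tuple T | P s]) (fun s x => P (rcons s x))).
pose f (p : k.-tuple T * T) := [tuple of rcons p.1 p.2].
have f_inj : injective f.
  by move=> [s x] [s' x'] /(congr1 val) /rcons_inj[/val_inj -> ->].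
rewrite -(card_imset _ f_inj); apply: subset_leq_card; apply/subsetP => _ /imsetP[p + ->].
by rewrite !inE => /andP[].
Qed.

Lemma card_uniq_transversals_ge (T : finType) (x0 : T) k (C : 'I_k -> {set T}) m :
  (forall i, m + k <= #|C i|) ->
  m ^ k <= #|[set s : k.-tuple T | uniq s && [forall i, tnth s i \in C i]]|.
Proof.
move=> C_ge.
pose P s := uniq s && [forall i : 'I_k, (i < size s) ==> (nth x0 s i \in C i)].
have -> : #|[set s : k.-tuple T | uniq s && [forall i, tnth s i \in C i]]|
    = #|[set s : k.-tuple T | P s]|.
  apply: eq_card => s; rewrite !inE /P; congr (_ && _); apply: eq_forallb => i.
  by rewrite size_tuple ltn_ord (tnth_nth x0).
rewrite -[k in leqLHS]card_ord -prod_nat_const.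
apply: (card_tuple_extend_ge (m := fun=> m)) => [|s lt_sk /andP[uniq_s /forallP s_in]].
  by apply/forallP.
apply: (@leq_trans #|C (Ordinal lt_sk) :\: [set x in s]|); last first.
  apply: subset_leq_card; apply/subsetP => x; rewrite !inE => /andP[xs xC].
  rewrite /P rcons_uniq xs uniq_s; apply/forallP => i; rewrite size_rcons ltnS nth_rcons.
  have := s_in i; case: (ltngtP i (size s)) => //= eq_is.
  by have -> : i = Ordinal lt_sk by apply: val_inj.
have : #|C (Ordinal lt_sk) :&: [set x in s]| <= size s.
  by apply: leq_trans (card_size s); rewrite -[leqRHS]cardsE subset_leq_card ?subsetIr.
by rewrite cardsD; have := C_ge (Ordinal lt_sk); lia.
Qed.

Lemma connected_boundary (I : finType) (G : rel I) (D : {set I}) :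
  (forall i j, connect G i j) -> D != set0 -> D != setT ->
  exists i j, [/\ i \in D, j \notin D & G i j].
Proof.
move=> G_conn /set0Pn[i0 i0D]; rewrite -subTset => /subsetPn[j0 _ j0D].
have /connectP[s] := G_conn i0 j0.
elim: s i0 i0D => [|i s IHs] i0 i0D /=; first by move=> _ j0E; rewrite j0E i0D in j0D.
case/andP=> Gi; have [iD|iD] := boolP (i \in D); first exact: IHs.
by exists i0, i.
Qed.

(* A tuple that is known on D is revealed edge by edge along the connected graph G. *)
Lemma card_agreeing_tuples_le (T : finType) k (G : rel 'I_k) (C : 'I_k -> T -> {set T}) t
    (Q : {set k.-tuple T}) (D : {set 'I_k}) (p0 : k.-tuple T) :
  (forall i j, connect G i j) -> D != set0 ->
  {in Q, forall p i j, G i j ->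
    (tnth p j \in C j (tnth p i)) && (#|C j (tnth p i)| <= t)} ->
  #|[set p in Q | [forall i in D, tnth p i == tnth p0 i]]| <= t ^ #|~: D|.
Proof.
move=> G_conn + QC; have [n] := ubnP #|~: D|; elim: n D p0 => // n IHn D p0.
set S := [set p in Q | _]; rewrite ltnS => leDn D0.
have [->|/set0Pn[p1]] := eqVneq S set0; first by rewrite cards0.
rewrite inE => /andP[p1Q /forall_inP p1D].
have [DT|/(connected_boundary G_conn D0)[i [j [iD jD Gij]]]] := eqVneq D setT.
  rewrite DT setCT cards0 expn0 -(cards1 p0); apply: subset_leq_card; apply/subsetP => p.
  rewrite !inE DT => /andP[_ /forall_inP eq_p]; apply/eqP/eq_from_tnth => h.
  by apply/eqP/eq_p; rewrite inE.
have cardDj : #|~: D| = #|~: (j |: D)|.+1.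
  by rewrite setCU [in RHS]setIC -setDE (cardsD1 j (~: D)) inE jD.
have /andP[_ leC] := QC p1 p1Q i j Gij; rewrite (eqP (p1D i iD)) in leC.
rewrite cardDj expnS; apply: (@leq_trans (#|C j (tnth p0 i)| * t ^ #|~: (j |: D)|)); last first.
  by rewrite leq_mul2r leC orbT.
apply: (leq_card_fibers (g := fun p => tnth p j)) => [p|z].
  rewrite inE => /andP[pQ /forall_inP pD].
  by have /andP[] := QC p pQ i j Gij; rewrite (eqP (pD i iD)).
set Sz := [set p in S | _]; have [->|/set0Pn[p2]] := eqVneq Sz set0; first by rewrite cards0.
rewrite !inE => /andP[/andP[p2Q /forall_inP p2D] /eqP p2j].
apply: leq_trans (IHn (j |: D) p2 _ _); last 2 first.
- by rewrite -cardDj.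
- by apply/set0Pn; exists j; rewrite setU11.
apply: subset_leq_card; apply/subsetP => p.
rewrite !inE => /andP[/andP[-> /forall_inP pD] /eqP pj]; apply/forall_inP => h.
by rewrite !inE => /predU1P[->|hD]; rewrite ?pj ?p2j // (eqP (pD h hD)) (eqP (p2D h hD)).
Qed.

(** * Copies of the rooted path and of its blow-up *)

Definition embeds (V W : finType) (F : rel V) (e : rel W) : Prop :=
  exists2 f : V -> W, injective f & {homo f : x y / F x y >-> e x y}.

Lemma embeds_subrel (V W : finType) (F : rel V) (e e' : rel W) :
  subrel e e' -> embeds F e -> embeds F e'.
Proof. by move=> sub_ee' [f f_inj f_hom]; exists f => // x y /f_hom/sub_ee'. Qed.

Lemma containsP n (E : {set 'I_n * 'I_n}) (V : finType) (F : rel V) :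
  reflect (embeds F (adj E)) (contains E F).
Proof.
apply: (iffP existsP) => [[f /andP[/injectiveP f_inj f_hom]]|[f f_inj f_hom]].
  by exists f => // x y Fxy; move/forallP/(_ x)/forallP/(_ y)/implyP: f_hom; apply.
exists [ffun x => f x]; apply/andP; split.
  by apply/injectiveP => x y; rewrite !ffunE => /f_inj.
by apply/forallP => x; apply/forallP => y; apply/implyP; rewrite !ffunE; exact: f_hom.
Qed.

Lemma adj_sym n (E : {set 'I_n * 'I_n}) : symmetric (adj E).
Proof. by move=> x y; rewrite /adj eq_sym orbC. Qed.

Lemma adj_irr n (E : {set 'I_n * 'I_n}) : irreflexive (adj E).
Proof. by move=> x; rewrite /adj eqxx. Qed.

Definition path_rel k : rel 'I_k := fun i j => (i.+1 == j :> nat) || (j.+1 == i :> nat).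

Lemma path_rel_sym k : symmetric (@path_rel k).
Proof. by move=> i j; rewrite /path_rel orbC. Qed.

Lemma path_rel_connected k (i j : 'I_k) : connect (@path_rel k) i j.
Proof.
wlog le_ij : i j / i <= j => [wlog_le|].
  have [/wlog_le//|/ltnW/wlog_le] := leqP i j.
  by rewrite (sym_connect_sym (@path_rel_sym k)).
case: j le_ij => j; elim: j => [|j IHj] lt_jk /= le_ij.
  by rewrite (_ : i = Ordinal lt_jk) ?connect0 //; apply: val_inj => /=; lia.
move: le_ij; rewrite leq_eqVlt => /predU1P[eq_ij|lt_ij].
  by rewrite (_ : i = Ordinal lt_jk) ?connect0 //; exact: val_inj.
apply: connect_trans (IHj (ltnW lt_jk) lt_ij) (connect1 _).
by rewrite /path_rel /= eqxx.
Qed.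

Lemma card_path_rel_le2 k (i : 'I_k) : #|[set j | path_rel j i]| <= 2.
Proof.
have le1 (P : pred 'I_k) : (forall j j', P j -> P j' -> j = j' :> nat) -> #|[set j | P j]| <= 1.
  by move=> P_inj; apply/card_le1_eqP => j j'; rewrite !inE => Pj Pj'; apply/val_inj/P_inj.
have -> : [set j | path_rel j i] =
    [set j : 'I_k | j.+1 == i :> nat] :|: [set j : 'I_k | i.+1 == j :> nat].
  by apply/setP => j; rewrite !inE.
apply: leq_trans (leq_card_setU _ _).1 _; rewrite -[2]/(1 + 1).
by apply: leq_add; apply: le1 => j j' /eqP + /eqP; lia.
Qed.

Lemma sorted_path_relP (V : finType) k (R : rel V) (s : k.-tuple V) :
  symmetric R -> reflect (forall i j, path_rel i j -> R (tnth s i) (tnth s j)) (sorted R s).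
Proof.
move=> R_sym; case: k s => [s|k s]; first by rewrite tuple0; left=> -[].
have x0 := thead s; apply: (iffP (sortedP x0)) => [s_sorted|s_path i].
  have step (i j : 'I_k.+1) : i.+1 = j -> R (tnth s i) (tnth s j).
    by move=> ij; rewrite !(tnth_nth x0) -ij; apply: s_sorted; rewrite size_tuple ij.
  by move=> i j /orP[] /eqP; [exact: step | rewrite R_sym; exact: step].
rewrite size_tuple => lt_ik.
have := s_path (Ordinal (ltnW lt_ik)) (Ordinal lt_ik).
by rewrite !(tnth_nth x0); apply; rewrite /path_rel eqxx.
Qed.

(* T_{4,7} is a comb with four teeth: the entries of r are its roots, those of p its path. *)
Definition comb_copy k (V : finType) (e : rel V) (r p : k.-tuple V) : bool :=
  [&& uniq (p ++ r), sorted e p & [forall i, e (tnth r i) (tnth p i)]].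

Lemma greedy_disjoint (V : finType) k l (P : pred (k.-tuple V)) :
  (forall X : {set V}, #|X| <= k * l -> exists2 p : k.-tuple V, P p & [disjoint p & X]) ->
  exists q : 'I_l -> k.-tuple V,
    (forall j, P (q j)) /\ (forall i j, i != j -> [disjoint q i & q j]).
Proof.
move=> avoid.
have [s [size_s Ps s_disj]] : exists s : seq (k.-tuple V),
    [/\ size s == l, all P s & pairwise (fun p p' => [disjoint p & p']) s].
  suff: forall i, i <= l -> exists s : seq (k.-tuple V),
      [/\ size s == i, all P s & pairwise (fun p p' => [disjoint p & p']) s] by apply.
  elim=> [|i IHi] lt_il; first by exists [::].
  have [s [/eqP size_s Ps s_disj]] := IHi (ltnW lt_il).
  have [|p Pp p_disj] := avoid [set x in flatten (map val s)].
    rewrite cardsE; apply: leq_trans (card_size _) _.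
    apply: (@leq_trans (k * size s)); last by rewrite size_s leq_mul2l (ltnW lt_il) orbT.
    elim: (s) => //= p s' IHs'; rewrite size_cat size_tuple mulnS; lia.
  exists (p :: s); split; rewrite /= ?size_s ?Pp ?s_disj ?andbT //.
  apply/allP => p' p's; apply: disjointWr p_disj; apply/subsetP => x xp'.
  by rewrite inE; apply/flatten_mapP; exists p'.
exists (tnth (Tuple size_s)); split=> [j|]; first exact/(allP Ps)/(mem_tnth j (Tuple size_s)).
have lt_disj (i j : 'I_l) : i < j -> [disjoint tnth (Tuple size_s) i & tnth (Tuple size_s) j].
  move=> lt_ij; set p0 := tnth _ i; rewrite /p0 !(tnth_nth p0).
  by apply: (pairwiseP p0 s_disj) => //; rewrite inE (eqP size_s).
move=> i j; rewrite -val_eqE neq_ltn => /orP[/lt_disj//|/lt_disj].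
by rewrite disjoint_sym.
Qed.

Lemma embeds_Tblowup (V : finType) (e : rel V) l (r : 4.-tuple V) : symmetric e ->
  (forall X : {set V}, #|X| <= 4 * l -> exists2 p, comb_copy e r p & [disjoint p & X]) ->
  embeds (@Tblowup l) e.
Proof.
move=> e_sym avoid; have [q [q_copy q_disj]] := greedy_disjoint avoid.
have [p0] : exists2 p, comb_copy e r p & [disjoint p & set0 : {set V}].
  by apply: avoid; rewrite cards0.
case/and3P; rewrite cat_uniq => /and3P[_ _ /tuple_uniqP r_inj] _ _ _.
have q_inj j : injective (tnth (q j)).
  by case/and3P: (q_copy j); rewrite cat_uniq => /and3P[/tuple_uniqP].
have rq_neq j i i' : tnth r i <> tnth (q j) i'.
  move=> eq_rq; case/and3P: (q_copy j); rewrite cat_uniq => /and3P[_ /hasPn q_notin_r _] _ _.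
  by have := q_notin_r _ (mem_tnth i r); rewrite eq_rq /= mem_tnth.
have q_step j := sorted_path_relP (q j) e_sym.
exists (fun t => match t with inl i => tnth r i | inr (j, i) => tnth (q j) i end).
  case=> [i|[j i]] [i'|[j' i']]; first by move/r_inj->.
  - by move/rq_neq.
  - by move/esym/rq_neq.
  - have [<- /q_inj->//|/q_disj/pred0P/(_ (tnth (q j) i)) /= + eq_q] := eqVneq j j'.
    by rewrite mem_tnth eq_q mem_tnth.
case=> [i|[j i]] [i'|[j' i']] //=.
- by move/eqP->; case/and3P: (q_copy j') => _ _ /forallP.
- by move/eqP->; rewrite e_sym; case/and3P: (q_copy j) => _ _ /forallP.
- by case/andP=> /eqP <- Gii'; apply/(q_step j); first by case/and3P: (q_copy j).
Qed.

Lemma leq_card_ex (V W : finType) (F : rel V) (h : rel W) n (P : {set W * W}) :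
  symmetric h -> irreflexive h -> #|W| <= n -> (forall x, exists y, F x y) -> ~ embeds F h ->
  (forall a b, (a, b) \in P -> h a b && ((b, a) \notin P)) -> #|P| <= ex n F.
Proof.
move=> h_sym h_irr le_Wn F_edge not_embeds P_oriented.
have [phi phi_inj] : exists phi : W -> 'I_n, injective phi.
  exists (fun a => widen_ord le_Wn (enum_rank a)).
  by move=> a b /(congr1 val) /= eq_ab; apply/enum_rank_inj/val_inj.
pose E := [set p | [exists a, exists b, (p == (phi a, phi b)) && h a b]].
have EP x y : reflect (exists a b, [/\ x = phi a, y = phi b & h a b]) ((x, y) \in E).
  rewrite inE; apply: (iffP existsP) => [[a /existsP[b /andP[/eqP[-> ->] hab]]]|].
    by exists a, b.
  by case=> a [b [-> -> hab]]; exists a; apply/existsP; exists b; rewrite eqxx.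
have adjP x y : adj E x y -> exists a b, [/\ x = phi a, y = phi b & h a b].
  case/andP=> _ /orP[/EP//|/EP[b [a [-> -> hba]]]].
  by exists a, b; rewrite h_sym.
have adj_phi a b : h a b -> adj E (phi a) (phi b).
  move=> hab; rewrite /adj (inj_eq phi_inj) (contraTneq _ hab) => [|->]; last by rewrite h_irr.
  by apply/orP; left; apply/EP; exists a, b.
have E_free : ~~ contains E F.
  apply/containsP => -[f f_inj f_hom].
  have /fin_all_exists[w fw] : forall x, exists a, f x = phi a.
    by move=> x; have [y /f_hom/adjP[a [b [-> _ _]]]] := F_edge x; exists a.
  apply: not_embeds; exists w => [x y eq_w|x y /f_hom]; first by apply: f_inj; rewrite !fw eq_w.
  by rewrite !fw => /adjP[a [b [/phi_inj -> /phi_inj ->]]].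
apply: (bigmax_sup E) E_free _; rewrite /num_edges.
pose g (p : W * W) := if phi p.1 < phi p.2 then (phi p.1, phi p.2) else (phi p.2, phi p.1).
have g_inj : {in P &, injective g}.
  move=> [a b] [c d] abP cdP; have /andP[_ baP] := P_oriented a b abP; rewrite /g /=.
  by case: ifP => _; case: ifP => _ [/phi_inj ac /phi_inj bd];
    rewrite ac bd ?cdP // in baP *.
rewrite -(card_in_imset g_inj); apply: subset_leq_card; apply/subsetP => _ /imsetP[[a b] abP ->].
have /andP[/adj_phi adj_ab _] := P_oriented a b abP; rewrite inE /g /=.
case: (ltngtP (phi a) (phi b)) => [lt_ab|lt_ba|/val_inj eq_ab] /=; first by rewrite lt_ab.
  by rewrite lt_ba adj_sym.
by rewrite eq_ab adj_irr in adj_ab.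
Qed.

(** * Heavy pairs and light copies *)

Definition nbrs (V : finType) (e : rel V) (x : V) : {set V} := [set y | e x y].

Definition common (V : finType) (e : rel V) x y : {set V} := nbrs e x :&: nbrs e y.

Definition heavy (V : finType) (e : rel V) t x y : bool := t <= #|common e x y|.

Definition heavy_partners (V : finType) (e : rel V) t x : {set V} :=
  [set w | (w != x) && heavy e t x w].

Section Codegrees.
Variables (I V : finType) (W : {set I}) (P : I -> {set V}).

Definition containing2 z z' : {set I} := [set w in W | (z \in P w) && (z' \in P w)].

Definition sparse_pairs s w : {set V * V} :=
  [set p in setX (P w) (P w) | #|containing2 p.1 p.2| < s].

Lemma sum_card_sparse_pairs s (Z : {set V}) : {in W, forall w, P w \subset Z} ->
  \sum_(w in W) #|sparse_pairs s w| <= s * #|Z| ^ 2.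
Proof.
move=> PZ; rewrite mulnC -mulnn -cardsX -sum_nat_const.
apply: (@leq_trans (\sum_(w in W) #|[set p in setX Z Z | p \in sparse_pairs s w]|)).
  apply: leq_sum => w /PZ/subsetP PwZ; apply: subset_leq_card; apply/subsetP => p.
  by rewrite !inE => /andP[/andP[/[dup] /PwZ-> -> /[dup] /PwZ-> ->] ->].
rewrite double_counting; apply: leq_sum => -[z z'] _.
have [lt_s|ge_s] := ltnP #|containing2 z z'| s; last first.
  by rewrite eq_card0 // => w; rewrite !inE /= ltnNge ge_s !andbF.
apply: leq_trans (ltnW lt_s); apply: subset_leq_card; apply/subsetP => w.
by rewrite !inE => /andP[-> /andP[/andP[-> ->]]].
Qed.

Lemma exists_few_sparse_pairs c s t (Z : {set V}) :
  {in W, forall w, (P w \subset Z) && (t <= #|P w|)} ->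
  c * s * #|Z| ^ 2 < t * \sum_(w in W) #|P w| ->
  exists2 w, w \in W & c * #|sparse_pairs s w| <= #|P w| ^ 2.
Proof.
move=> PZ lt_sum; apply: exists_leq_of_sum.
  by apply: contraTneq lt_sum => ->; rewrite big_set0 muln0.
have PZ' : {in W, forall w, P w \subset Z} by move=> w /PZ/andP[].
rewrite -big_distrr /=; apply: (@leq_trans (c * s * #|Z| ^ 2)).
  by rewrite -mulnA leq_mul2l sum_card_sparse_pairs // orbT.
apply: leq_trans (ltnW lt_sum) _; rewrite big_distrr /=; apply: leq_sum => w /PZ/andP[_ le_t].
by rewrite -mulnn leq_mul2r le_t orbT.
Qed.
End Codegrees.

Lemma card_high_degree_le (T : finType) (S : {set T}) (R : rel T) a b :
  a * b * #|[set p in setX S S | R p.1 p.2]| <= #|S| ^ 2 ->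
  a * #|[set z in S | #|S| < b * #|[set z' in S | R z z']|]| <= #|S|.
Proof.
set B := [set z in S | _] => le_pairs; have [S0|S0] := posnP #|S|.
  have : #|B| <= #|S| by apply/subset_leq_card/subsetP => z; rewrite inE => /andP[].
  by rewrite S0 leqn0 => /eqP->; rewrite muln0.
rewrite -(leq_pmul2r S0) mulnn -mulnA; apply: leq_trans le_pairs.
rewrite -mulnA leq_mul2l; apply/orP; right.
apply: leq_trans (markov_card (mem S) (fun z => b * #|[set z' in S | R z z']|) #|S|) _.
rewrite -big_distrr leq_mul2l -card_set_pair; apply/orP; right.
by apply/eq_leq/eq_card => -[z z']; rewrite !inE andbA.
Qed.

Section BlowupFree.
Variables (V : finType) (e : rel V).
Hypotheses (e_sym : symmetric e) (e_irr : irreflexive e).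

Lemma common_edges x y z : z \in common e x y -> [/\ e x z, e z x, e y z & e z y].
Proof. by rewrite !inE => /andP[xz yz]; rewrite xz yz ![e z _]e_sym xz yz. Qed.

Lemma edge_neq x y : e x y -> x != y.
Proof. by apply: contraTneq => ->; rewrite e_irr. Qed.

Section Avoiding.
Variables (s t : nat) (x w : V).
Local Notation W := (heavy_partners e t x).
Local Notation codeg := (fun z z' => #|containing2 W (common e x) z z'|).

Lemma comb_copy_avoiding (r2 r4 : V) (X : {set V}) :
  w \in W -> r2 \in common e x w -> r4 \in common e x w -> r2 != r4 ->
  4 * #|[set z in common e x w | codeg r2 z < s]| <= #|common e x w| ->
  4 * #|[set z in common e x w | codeg r4 z < s]| <= #|common e x w| ->
  #|X| + 8 <= s -> s <= t -> 2 * (#|X| + 5) <= #|common e x w| ->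
  exists2 p, comb_copy e [tuple x; r2; w; r4] p & [disjoint p & X].
Proof.
set L2 := [set z in _ | codeg r2 z < s]; set L4 := [set z in _ | codeg r4 z < s].
rewrite inE => /andP[wx _] r2P r4P r24 leL2 leL4 leXs le_st leXd.
have lt_Xs j : j < 8 -> #|X| + j < s.
  by move=> lt_j8; apply: leq_trans leXs; rewrite ltn_add2l.
have [|v3 []] := @exists_avoiding _ (common e x w :\: (L2 :|: L4)) X [:: x; r2; w; r4].
  have := subset_leq_card (subsetIr (common e x w) (L2 :|: L4)).
  by have := (leq_card_setU L2 L4).1; rewrite cardsD /=; lia.
case/setDP=> v3P; rewrite in_setU negb_or [v3 \in L2]inE [v3 \in L4]inE v3P /= -!leqNgt.
case/andP=> ge2 ge4 v3X v3u.
have [|v2 [+ v2X v2u]] := @exists_avoiding _ (containing2 W (common e x) r2 v3) X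
  [:: v3; x; r2; w; r4]; first by apply: leq_trans ge2; exact: lt_Xs.
rewrite inE => /and3P[v2W r2v2 v3v2].
have [|v4 [+ v4X v4u]] := @exists_avoiding _ (containing2 W (common e x) r4 v3) X
  [:: v2; v3; x; r2; w; r4]; first by apply: leq_trans ge4; exact: lt_Xs.
rewrite inE => /and3P[_ r4v4 v3v4].
have [|v1 [v1v2 v1X v1u]] := @exists_avoiding _ (common e x v2) X [:: v4; v2; v3; x; r2; w; r4].
  move: v2W; rewrite inE => /andP[_]; apply: leq_trans; apply: leq_trans le_st.
  exact: lt_Xs.
have [xr2 _ wr2 r2w] := common_edges r2P; have [xr4 _ wr4 _] := common_edges r4P.
have [xv1 _ v2v1 v12] := common_edges v1v2; have [_ _ v23 _] := common_edges v3v2.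
have [_ _ _ r2v2e] := common_edges r2v2; have [_ _ _ v34] := common_edges v3v4.
have [_ _ wv3 _] := common_edges v3P; have [_ _ _ r4v4e] := common_edges r4v4.
exists [tuple v1; v2; v3; v4]; last first.
  by rewrite disjoint_has; apply/hasPn => v; rewrite !inE => /or4P[] /eqP->.
apply/and3P; split.
- have: uniq [:: v1, v4, v2, v3 & [:: x; r2; w; r4]].
    rewrite cons_uniq v1u cons_uniq v4u cons_uniq v2u cons_uniq v3u /= !inE !negb_or.
    by rewrite (edge_neq xr2) (edge_neq r2w) (edge_neq wr4) (edge_neq xr4) eq_sym wx r24.
  congr (is_true _); apply: perm_uniq; rewrite perm_cons.
  by rewrite (perm_catCA [:: v4] [:: v2; v3]).
- by rewrite /= v12 v23 v34.
- by apply/forallP => -[[|[|[|[|//]]]] lt_i4]; rewrite (tnth_nth x) (tnth_nth x).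
Qed.
End Avoiding.

(* If many 2-paths x - z - w have a heavy pair (x, w) of ends, then for some w most pairs in
   N(x) :&: N(w) have large codegree, and copies of T rooted at x, r2, w, r4 are found
   greedily, with v3 in N(x) :&: N(w) and v2, v4 among the common partners. *)
Lemma blowup_free_heavy_paths l M t x :
  8 * (4 * l + 8) * M <= t -> ~ embeds (@Tblowup l) e ->
  M * \sum_(z in nbrs e x) #|heavy_partners e t x :&: nbrs e z| <= #|nbrs e x| ^ 2.
Proof.
set s := 4 * l + 8 => le_t nembeds; rewrite leqNgt; apply/negP => lt_sum; apply: nembeds.
set W := heavy_partners e t x; set sumH := \sum_(z in _) _ in lt_sum.
have sumHE : sumH = \sum_(w in W) #|common e x w|.
  rewrite /sumH; under eq_bigr => z _ do [have -> : #|W :&: nbrs e z| = #|[set w in W | e w z]|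
    by apply: eq_card => w; rewrite !inE e_sym].
  rewrite double_counting; apply: eq_bigr => w _; apply: eq_card => z.
  by rewrite !inE.
have [||w wW sparse_w] := @exists_few_sparse_pairs _ _ W (common e x) 8 s t (nbrs e x).
- by move=> w; rewrite inE => /andP[_ heavy_w]; rewrite subsetIl.
- rewrite -sumHE; apply: (@leq_trans (8 * s * (M * sumH))).
    by rewrite ltn_pmul2l // muln_gt0 addn_gt0 orbT.
  by rewrite mulnA leq_mul2r le_t orbT.
have le_td : t <= #|common e x w| by move: wW; rewrite inE => /andP[].
have M0 : 0 < M by case: (M) lt_sum.
pose B := [set z in common e x w | #|common e x w| <
  4 * #|[set z' in common e x w | #|containing2 W (common e x) z z'| < s]|].
have leB : 2 * #|B| <= #|common e x w| by exact: card_high_degree_le.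
have /card_gt1P[r2 [r4 []]] : 1 < #|common e x w :\: B|.
  rewrite cardsD; have := subset_leq_card (subsetIr (common e x w) B); nia.
case/setDP=> r2P + /setDP[r4P]; rewrite [r2 \in B]inE [r4 \in B]inE r2P r4P /= -!leqNgt.
move=> few2 few4 r24.
apply: (embeds_Tblowup (r := [tuple x; r2; w; r4])) => // X leX.
by apply: (comb_copy_avoiding wW r2P r4P r24 few2 few4); nia.
Qed.
End BlowupFree.

Section LightCopies.
Variables (V : finType) (e : rel V).
Hypothesis e_sym : symmetric e.

Definition light_copy k t (r p : k.-tuple V) : bool :=
  comb_copy e r p &&
  [forall i, forall j, path_rel i j ==> ~~ heavy e t (tnth p i) (tnth r j)].

Lemma card_light_copies_at k t (r : k.-tuple V) (Q : {set k.-tuple V}) i w :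
  {in Q, forall p, light_copy t r p} -> #|[set p in Q | tnth p i == w]| <= t ^ k.-1.
Proof.
move=> Q_light; have [->|/set0Pn[p0]] := eqVneq [set p in Q | tnth p i == w] set0.
  by rewrite cards0.
rewrite inE => /andP[_ /eqP p0i]; rewrite -[k in k.-1]card_ord -cardsT (cardsD1 i) inE /=.
rewrite setTD.
apply: leq_trans (card_agreeing_tuples_le (C := fun j x => common e x (tnth r j)) (t := t)
  (Q := Q) p0 (@path_rel_connected k) (_ : [set i] != set0) _); last 2 first.
- by apply/set0Pn; exists i; rewrite set11.
- move=> p /Q_light/andP[/and3P[_ /(sorted_path_relP p e_sym) p_path /forallP legs]].
  move=> /forallP light_p i1 j1 Gij; rewrite !inE p_path // legs /= ltnW // ltnNge.
  by have /forallP/(_ j1)/implyP/(_ Gij) := light_p i1.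
apply: subset_leq_card; apply/subsetP => p; rewrite !inE => /andP[-> /eqP p_i].
by apply/forall_inP => j /set1P->; rewrite p_i p0i.
Qed.

Lemma card_light_copies_meeting k t (r : k.-tuple V) (Q : {set k.-tuple V}) (X : {set V}) :
  {in Q, forall p, light_copy t r p} ->
  #|[set p in Q | ~~ [disjoint p & X]]| <= #|X| * (k * t ^ k.-1).
Proof.
move=> Q_light.
apply: (@leq_trans #|\bigcup_(x in X) \bigcup_i [set p in Q | tnth p i == x]|).
  apply: subset_leq_card; apply/subsetP => p; rewrite inE => /andP[pQ /pred0Pn[x /= /andP[]]].
  case/tnthP=> i -> xX; apply/bigcupP; exists (tnth p i) => //.
  by apply/bigcupP; exists i; rewrite // inE pQ eqxx.
apply: card_bigcup_le => x _; rewrite -[k in k * _]card_ord.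
by apply: card_bigcup_le => i _; exact: card_light_copies_at Q_light.
Qed.

Lemma embeds_Tblowup_light l t (r : 4.-tuple V) (Q : {set 4.-tuple V}) :
  {in Q, forall p, light_copy t r p} -> 4 * l * (4 * t ^ 3) < #|Q| ->
  embeds (@Tblowup l) e.
Proof.
move=> Q_light lt_Q; apply: (embeds_Tblowup (r := r)) => // X leX.
have /subsetPn[p pQ] : ~~ (Q \subset [set p in Q | ~~ [disjoint p & X]]).
  apply: contraL lt_Q => /subset_leq_card leQ; rewrite -leqNgt; apply: leq_trans leQ _.
  by apply: leq_trans (card_light_copies_meeting X Q_light) _; rewrite leq_mul2r leX orbT.
rewrite inE pQ negbK => p_disj; exists p => //.
by case/andP: (Q_light p pQ).
Qed.
End LightCopies.

(** * Almost regular graphs *)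

Section Walks.
Variables (V : finType) (e : rel V).
Hypothesis e_sym : symmetric e.

Lemma card_walks_pair_le k (i j : 'I_k) (R : rel V) D : i != j ->
  (forall x, #|nbrs e x| <= D) ->
  #|[set s : k.-tuple V | sorted e s && R (tnth s i) (tnth s j)]| <=
    #|[set p | R p.1 p.2]| * D ^ (k - 2).
Proof.
move=> neq_ij leD; set Q := [set s : k.-tuple V | _].
apply: (leq_card_fibers (g := fun s => (tnth s i, tnth s j))) => [s|xy].
  by rewrite !inE => /andP[].
have [->|/set0Pn[s0]] := eqVneq [set s in Q | (tnth s i, tnth s j) == xy] set0.
  by rewrite cards0.
rewrite inE => /andP[_ /eqP s0_xy].
have -> : k - 2 = #|~: [set i; j]| by rewrite cardsCs setCK card_ord cards2 neq_ij.
apply: leq_trans (card_agreeing_tuples_le (C := fun _ x => nbrs e x) (t := D) (Q := Q) s0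
  (@path_rel_connected k) (_ : [set i; j] != set0) _); last 2 first.
- by apply/set0Pn; exists i; rewrite !inE eqxx.
- move=> s; rewrite inE => /andP[/(sorted_path_relP s e_sym) s_path _] i1 j1 Gij.
  by rewrite inE s_path //=; exact: leD.
apply: subset_leq_card; apply/subsetP => s; rewrite inE => /andP[sQ /eqP].
rewrite -s0_xy inE sQ /= => -[eq_i eq_j]; apply/forall_inP => h /set2P[]->.
  by rewrite eq_i.
by rewrite eq_j.
Qed.

Lemma card_paths_ge k (A : {set V}) d : irreflexive e ->
  (forall x y, e x y -> x \in A) -> {in A, forall x, d <= #|nbrs e x|} ->
  #|A| * (d - k) ^ k <= #|[set s : k.+1.-tuple V | uniq s && sorted e s]|.
Proof.
move=> e_irr eA dA; pose P s := [&& all (mem A) s, uniq s & sorted e s].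
apply: (@leq_trans #|[set s : k.+1.-tuple V | P s]|); last first.
  by apply: subset_leq_card; apply/subsetP => s; rewrite !inE => /and3P[_ -> ->].
pose m i := if i is _.+1 then d - k else #|A|.
have -> : #|A| * (d - k) ^ k = \prod_(i < k.+1) m i.
  by rewrite big_ord_recl prod_nat_const card_ord.
apply: card_tuple_extend_ge => // -[|x s] /= lt_sk.
  by move=> _; apply: subset_leq_card; apply/subsetP => x xA; rewrite inE /P /= !andbT.
case/and3P=> sA uniq_s path_s.
have lastA : last x s \in A by apply: (allP (_ : all (mem A) (x :: s))) (mem_last x s).
apply: (@leq_trans #|nbrs e (last x s) :\: [set y in belast x s]|).
  rewrite cardsD leq_sub ?dA //; apply: (@leq_trans (size s)); last exact: ltnW.
  apply: leq_trans (subset_leq_card (subsetIr _ _)) _.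
  by rewrite cardsE -(size_belast x s) card_size.
apply: subset_leq_card; apply/subsetP => y; rewrite !inE => /andP[ys ey].
have y_new : y \notin x :: s.
  by rewrite lastI mem_rcons in_cons negb_or ys andbT; apply: contraTneq ey => ->; rewrite e_irr.
have yA : y \in A by apply: (eA y (last x s)); rewrite e_sym.
rewrite -rcons_cons /P all_rcons rcons_uniq y_new /= rcons_path ey andbT.
by apply/and3P; split=> //; apply/andP.
Qed.
End Walks.

Definition almost_regular (V : finType) (e : rel V) (A : {set V}) d K : Prop :=
  (forall x y, e x y -> x \in A) /\ {in A, forall x, d <= #|nbrs e x| <= K * d}.

Section AlmostRegular.
Variables (V : finType) (e : rel V) (A : {set V}) (d K M t : nat).
Hypotheses (e_sym : symmetric e) (e_irr : irreflexive e).
Hypothesis e_reg : almost_regular e A d K.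
Hypothesis few_heavy_paths : forall x,
  M * \sum_(z in nbrs e x) #|heavy_partners e t x :&: nbrs e z| <= #|nbrs e x| ^ 2.

Lemma nbrs_out x : x \notin A -> nbrs e x = set0.
Proof.
have [eA _] := e_reg; move=> xA; apply/setP => y; rewrite !inE.
by apply: contraNF xA => /eA.
Qed.

Lemma card_nbrs_le x : #|nbrs e x| <= K * d.
Proof.
have [/e_reg.2/andP[]//|/nbrs_out->] := boolP (x \in A).
by rewrite cards0.
Qed.

Lemma card_nbrs_ge x y : e x y -> d <= #|nbrs e x|.
Proof. by have [eA dA] := e_reg; move/eA/dA/andP=> []. Qed.

Definition overloaded x z : bool :=
  e x z && (d < 8 * #|heavy_partners e t x :&: nbrs e z|).

Definition bad_step x z : bool := overloaded x z || overloaded z x.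

Definition good_path k (p : k.-tuple V) : bool :=
  [&& uniq p, sorted e p & sorted [rel x y | ~~ bad_step x y] p].

Lemma card_overloaded x : 0 < d -> M * #|[set z | overloaded x z]| <= 8 * K ^ 2 * d.
Proof.
move=> d0; rewrite -(leq_pmul2r d0) -mulnA.
apply: (@leq_trans (M * (8 * \sum_(z in nbrs e x) #|heavy_partners e t x :&: nbrs e z|))).
  rewrite leq_mul2l big_distrr; apply/orP; right.
  apply: leq_trans (markov_card (mem (nbrs e x)) _ d).
  by rewrite leq_mul2r; apply/orP; right; apply/eq_leq/eq_card => z; rewrite !inE.
apply: (@leq_trans (8 * (K * d) ^ 2)); last by apply/eq_leq; lia.
rewrite mulnCA leq_mul2l; apply/orP; right; apply: leq_trans (few_heavy_paths x) _.
by rewrite leq_exp2r ?card_nbrs_le.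
Qed.

Lemma card_bad_steps : 0 < d ->
  M * #|[set p | bad_step p.1 p.2]| <= 16 * K ^ 2 * d * #|A|.
Proof.
move=> d0; pose Q := [set p | overloaded p.1 p.2].
have leQ : M * #|Q| <= 8 * K ^ 2 * d * #|A|.
  have -> : #|Q| = \sum_(x in A) #|[set z | overloaded x z]|.
    rewrite -(card_set_pair (mem A) overloaded); apply: eq_card => -[x z].
    by rewrite !inE /= andb_idl // => /andP[/e_reg.1].
  rewrite big_distrr mulnC -sum_nat_const; apply: leq_sum => x _; exact: card_overloaded.
have swap_inj : injective (fun p : V * V => (p.2, p.1)) by move=> [x y] [x' y'] [-> ->].
have leU : #|[set p | bad_step p.1 p.2]| <= #|Q| + #|Q|.
  rewrite -[X in _ <= _ + X](card_imset _ swap_inj).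
  apply: leq_trans (leq_card_setU _ _).1; apply: subset_leq_card; apply/subsetP => -[x z].
  rewrite inE => /orP[] over_xz; apply/setUP; [left|right]; first by rewrite inE.
  by apply/imsetP; exists (z, x); rewrite ?inE.
apply: (@leq_trans (M * (#|Q| + #|Q|))); first by rewrite leq_mul2l leU orbT.
by lia.
Qed.

Lemma card_good_paths : 192 * K ^ 4 < M -> 32 <= d ->
  #|A| * d ^ 3 <= 4 * #|[set p : 4.-tuple V | good_path p]|.
Proof.
move=> ltM le32; set n := #|A|; set good := [set p | _].
pose paths := [set p : 4.-tuple V | uniq p && sorted e p].
pose bad := [set p | bad_step p.1 p.2].
pose walks_bad_at (i : 'I_3) := [set p : 4.-tuple V | sorted e p &&
  bad_step (tnth p (widen_ord (leqnSn 3) i)) (tnth p (lift ord0 i))].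
have le_paths : n * d ^ 3 <= 2 * #|paths|.
  apply: (@leq_trans (2 * (n * (d - 3) ^ 3))); last first.
    by rewrite leq_mul2l /=; apply: (card_paths_ge e_sym 3 e_irr e_reg.1) => x /e_reg.2/andP[].
  rewrite mulnCA leq_mul2l; apply/orP; right.
  have -> : d = (d - 3) + 3 by lia.
  have : 29 <= d - 3 by lia.
  by move: (d - 3) => c; rewrite addnK; nia.
have cover : paths \subset good :|: \bigcup_i walks_bad_at i.
  apply/subsetP => p; rewrite inE => /andP[uniq_p path_p]; rewrite inE [p \in good]inE.
  rewrite /good_path uniq_p path_p /= orbC -implyNb; apply/implyP => p_out.
  have x0 := thead p; apply/(sortedP x0) => i; rewrite size_tuple => lt_i3 /=.
  apply: contra p_out => bad_i; apply/bigcupP; exists (Ordinal (lt_i3 : i < 3)) => //.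
  by rewrite inE path_p !(tnth_nth x0).
have le_bad i : #|walks_bad_at i| <= #|bad| * (K * d) ^ 2.
  apply: (card_walks_pair_le e_sym) card_nbrs_le.
  by rewrite -val_eqE /= /bump neq_ltn ltnSn.
have few_bad : 4 * (3 * (#|bad| * (K * d) ^ 2)) <= n * d ^ 3.
  rewrite -(leq_pmul2l (leq_ltn_trans (leq0n _) ltM)).
  apply: (@leq_trans (192 * K ^ 4 * (n * d ^ 3))).
    have := card_bad_steps (leq_trans (isT : 0 < 32) le32); rewrite -/n -/bad; nia.
  by rewrite leq_mul2r (ltnW ltM) orbT.
have := leq_trans (subset_leq_card cover) (leq_card_setU _ _).1.
have : #|\bigcup_i walks_bad_at i| <= 3 * (#|bad| * (K * d) ^ 2).
  by apply: leq_trans (card_bigcup_le (fun i _ => le_bad i)) _; rewrite card_ord.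
lia.
Qed.

Lemma card_nbrs_path_ge k (p : k.-tuple V) i : 1 < k -> sorted e p -> d <= #|nbrs e (tnth p i)|.
Proof.
move=> k1 /(sorted_path_relP p e_sym) p_path.
have [||i' [j [/set1P-> _ /p_path]]] := @connected_boundary _ _ [set i] (@path_rel_connected k).
- by apply/set0Pn; exists i; rewrite set11.
- by apply: contraTneq k1 => set1T; rewrite -[k]card_ord -cardsT -set1T cards1.
exact: card_nbrs_ge.
Qed.

Lemma good_path_not_overloaded k (p : k.-tuple V) i j :
  good_path p -> path_rel i j -> ~~ overloaded (tnth p i) (tnth p j).
Proof.
have bad_sym : symmetric [rel x y | ~~ bad_step x y] by move=> x y; rewrite /= /bad_step orbC.
case/and3P=> _ _ /(sorted_path_relP p bad_sym) p_good /p_good.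
by rewrite /= negb_or => /andP[].
Qed.

Lemma card_light_roots k (p : k.-tuple V) : 8 * k <= d -> 1 < k -> good_path p ->
  d./2 ^ k <= #|[set r : k.-tuple V | all (mem A) r && light_copy e t r p]|.
Proof.
move=> le_kd k1 p_good; have /and3P[uniq_p path_p _] := p_good.
have p_path := elimT (sorted_path_relP p e_sym) path_p.
pose H i := \bigcup_(j in [set j | path_rel j i])
  (heavy_partners e t (tnth p j) :&: nbrs e (tnth p i)).
pose C i := nbrs e (tnth p i) :\: ([set x in p] :|: H i).
have leH i : #|H i| <= 2 * (d %/ 8).
  apply: leq_trans (card_bigcup_le (n := d %/ 8) _) _ => [j|]; last first.
    by rewrite leq_mul2r card_path_rel_le2 orbT.
  rewrite inE leq_divRL // mulnC => Gji; rewrite leqNgt.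
  by have := good_path_not_overloaded p_good Gji; rewrite /overloaded p_path.
have C_ge i : d./2 + k <= #|C i|.
  have le_d := card_nbrs_path_ge i k1 path_p; rewrite cardsD.
  have := subset_leq_card (subsetIr (nbrs e (tnth p i)) ([set x in p] :|: H i)).
  have := (leq_card_setU [set x in p] (H i)).1; have := leH i.
  have : #|[set x in p]| <= k by rewrite cardsE -[leqRHS](size_tuple p) card_size.
  lia.
have x0 := tnth p (Ordinal (ltnW k1)).
apply: leq_trans (card_uniq_transversals_ge x0 C_ge) _.
apply: subset_leq_card; apply/subsetP => r; rewrite !inE => /andP[uniq_r /forallP rC].
have r_in i : [/\ e (tnth p i) (tnth r i), tnth r i \notin p & tnth r i \notin H i].
  by have /setDP[] := rC i; rewrite !inE negb_or => -> /andP[].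
apply/and3P; split.
- apply/allP => _ /tnthP[i ->]; have [pr _ _] := r_in i.
  by apply: (e_reg.1 _ (tnth p i)); rewrite e_sym.
- apply/and3P; split=> //; last by apply/forallP => i; rewrite e_sym; have [] := r_in i.
  rewrite cat_uniq uniq_p uniq_r andbT; apply/hasPn => _ /tnthP[i ->].
  by have [] := r_in i.
apply/forallP => i; apply/forallP => j; apply/implyP => Gij.
have [prj rp rH] := r_in j; apply: contra rH => heavy_ij.
apply/bigcupP; exists i; first by rewrite inE.
apply/setIP; split; last by rewrite inE.
by rewrite in_set heavy_ij andbT; apply: contraNneq rp => ->; exact: mem_tnth.
Qed.
End AlmostRegular.

Lemma blowup_free_almost_regular l K : exists C, forall (V : finType) (e : rel V) A d,
  symmetric e -> irreflexive e -> ~ embeds (@Tblowup l) e ->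
  almost_regular e A d K -> A != set0 -> 32 <= d -> d ^ 7 <= C * #|A| ^ 3.
Proof.
pose M := (192 * K ^ 4).+1; pose t := 8 * (4 * l + 8) * M; pose L := 4 * l * (4 * t ^ 3).
exists (324 * L) => V e A d e_sym e_irr nembeds e_reg A0 le32; set n := #|A|.
have few_heavy x := blowup_free_heavy_paths e_sym e_irr x (leqnn t) nembeds.
set good := [set p : 4.-tuple V | good_path e d t p].
have many_good : n * d ^ 3 <= 4 * #|good|.
  exact: (card_good_paths e_sym e_irr e_reg few_heavy (ltnSn _) le32).
have many_roots : #|good| * d./2 ^ 4 <= n ^ 4 * L.
  rewrite /n -card_set_tuple_on -!sum_nat_const.
  apply: (@leq_trans (\sum_(p in good) #|[set r in [set r : 4.-tuple V | all (mem A) r] |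
      light_copy e t r p]|)).
    apply: leq_sum => p; rewrite inE => p_good.
    apply: leq_trans (card_light_roots e_sym e_reg _ _ p_good) _ => //.
    by apply: subset_leq_card; apply/subsetP => r; rewrite !inE.
  rewrite double_counting; apply: leq_sum => r _; rewrite leqNgt; apply/negP => lt_L.
  apply: nembeds; apply: (embeds_Tblowup_light e_sym (t := t) (r := r)) lt_L => p.
  by rewrite inE => /andP[].
have le_d4 : d ^ 4 <= 81 * d./2 ^ 4.
  apply: (@leq_trans ((3 * d./2) ^ 4)); last by apply/eq_leq; lia.
  by rewrite leq_exp2r //; lia.
have n0 : 0 < n by rewrite card_gt0.
rewrite -(leq_pmul2l n0); apply: (@leq_trans ((n * d ^ 3) * d ^ 4)); first by apply/eq_leq; lia.
apply: leq_trans (leq_mul many_good le_d4) _.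
apply: (@leq_trans (324 * (#|good| * d./2 ^ 4))); first by apply/eq_leq; lia.
by apply: (@leq_trans (324 * (n ^ 4 * L))); [rewrite leq_mul2l many_roots | apply/eq_leq; lia].
Qed.

Lemma leq_double_divn m n : 0 < n %/ m -> n <= 2 * m * (n %/ m).
Proof.
case: m => [|m] divn0; first by rewrite divn0 in divn0.
by apply: leq_trans (ltnW (ltn_ceil n (ltn0Sn m))) _; nia.
Qed.

(** * Reduction to almost regular graphs *)

Section Volume.
Variables (V : finType) (e : rel V).
Hypotheses (e_sym : symmetric e) (e_irr : irreflexive e).
Implicit Types S A B T : {set V}.

Definition degree_in S x : nat := #|nbrs e x :&: S|.

Definition volume S : nat := \sum_(x in S) degree_in S x.

Definition induced S : rel V := fun x y => [&& x \in S, y \in S & e x y].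

Lemma induced_sym S : symmetric (induced S).
Proof. by move=> x y; rewrite /induced e_sym andbCA. Qed.

Lemma induced_irr S : irreflexive (induced S).
Proof. by move=> x; rewrite /induced e_irr !andbF. Qed.

Lemma nbrs_induced S x : x \in S -> nbrs (induced S) x = nbrs e x :&: S.
Proof. by move=> xS; apply/setP => y; rewrite !inE /induced xS /= andbC. Qed.

Lemma degree_inS S S' x : S \subset S' -> degree_in S x <= degree_in S' x.
Proof. by move=> sub_SS'; apply/subset_leq_card/setIS. Qed.

Lemma volume_le_square S : volume S <= #|S| ^ 2.
Proof.
rewrite -mulnn -sum_nat_const; apply: leq_sum => x _.
exact/subset_leq_card/subsetIr.
Qed.

Lemma sum_degree_in_sym S T : \sum_(x in S) degree_in T x = \sum_(y in T) degree_in S y.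
Proof.
rewrite (eq_bigr (fun x => #|[set y in T | e x y]|)) => [|x _].
  rewrite double_counting; apply: eq_bigr => y _; apply: eq_card => x.
  by rewrite !inE andbC e_sym.
by apply: eq_card => y; rewrite !inE andbC.
Qed.

Lemma volume_le_sub S B : B \subset S ->
  volume S <= volume (S :\: B) + 2 * \sum_(x in B) degree_in S x.
Proof.
move=> BS; have := sum_degree_in_sym (S :\: B) B.
have : \sum_(x in B) degree_in (S :\: B) x <= \sum_(x in B) degree_in S x.
  by apply: leq_sum => x _; rewrite degree_inS ?subsetDl.
have : \sum_(x in S :\: B) degree_in S x = volume (S :\: B) + \sum_(x in S :\: B) degree_in B x.
  rewrite -big_split; apply: eq_bigr => x _ /=; rewrite addnC.
  by rewrite /degree_in -(cardsID B (nbrs e x :&: S)) -setIDA -setIA (setIidPr BS).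
by rewrite [volume S](big_setID B) /= (setIidPr BS); lia.
Qed.

Lemma exists_min_degree_subset S : 0 < volume S ->
  exists A, [/\ A \subset S, A != set0 &
    {in A, forall x, volume S <= 2 * #|S| * degree_in A x}].
Proof.
move=> volS; pose P A := [&& A \subset S, A != set0 & volume S * #|A| <= #|S| * volume A].
have PS : P S.
  by rewrite /P subxx mulnC leqnn andbT; apply: contraTneq volS => ->; rewrite /volume big_set0.
case: (@arg_minnP _ S P (fun A => #|A|) PS) => A /and3P[AS A0 dense_A] A_min.
exists A; split=> // x xA; have cardA := cardsD1 x A; rewrite xA add1n in cardA.
have := @volume_le_sub A [set x]; rewrite sub1set xA big_set1 => /(_ isT) leA.
have [Ax0|Ax_n0] := eqVneq (A :\ x) set0.
  by move: leA dense_A; rewrite cardA Ax0 cards0 /volume big_set0; nia.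
have : ~~ P (A :\ x) by apply/negP => /A_min; rewrite cardA ltnn.
rewrite /P (subset_trans (subsetDl _ _) AS) Ax_n0 /= -ltnNge cardA in dense_A *.
nia.
Qed.

Lemma exists_denser_subset k S : 1 < k -> k <= #|S| ->
  let B := [set x in S | k * volume S < degree_in S x * #|S|] in
  2 * volume (S :\: B) < volume S ->
  exists2 T : {set V}, #|T| <= 2 * (#|S| %/ k) & (#|S| %/ k) * volume S <= 4 * #|S| * volume T.
Proof.
move=> k1 le_kS B lt_vol; set s := #|S| in le_kS *; set b := s %/ k.
have BS : B \subset S by apply/subsetP => x; rewrite inE => /andP[].
pose degB := \sum_(x in B) degree_in S x.
have vol_degB : volume S <= 4 * degB by have := volume_le_sub BS; rewrite -/degB; lia.
have leB : #|B| <= b.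
  have vol0 : 0 < volume S by exact: leq_ltn_trans lt_vol.
  rewrite leq_divRL ?(ltnW k1) // -(leq_pmul2r vol0) -mulnA.
  apply: (@leq_trans (degB * s)).
    rewrite /degB big_distrl /= -sum_nat_const.
    by apply: leq_sum => x; rewrite inE => /andP[_ /ltnW].
  rewrite mulnC leq_mul2l /volume [in leqRHS](big_setID B) /= (setIidPr BS).
  by rewrite leq_addr orbT.
have [|T [TS cardT heavyT]] := exists_heaviest_subset (degree_in B) (S := S) (b := b).
  exact: leq_div.
exists (B :|: T); first by have := (leq_card_setU B T).1; lia.
have volBT : b * degB <= s * volume (B :|: T).
  rewrite /degB sum_degree_in_sym; apply: leq_trans heavyT _; rewrite leq_mul2l; apply/orP; right.
  rewrite /volume [leqRHS](big_setID T) /= (setIidPr (subsetUr B T)).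
  by apply: leq_trans (leq_addr _ _); apply: leq_sum => x _; rewrite degree_inS ?subsetUl.
by apply: (@leq_trans (b * (4 * degB))); [rewrite leq_mul2l vol_degB orbT | lia].
Qed.

(* In the first case T contains the vertices whose degree is above k times the average; in the
   second these are deleted, and A is a subset of the rest with large minimum degree. *)
Lemma denser_or_almost_regular k S : 1 < k -> k <= #|S| -> 0 < volume S ->
  (exists2 T : {set V}, #|T| <= 2 * (#|S| %/ k) & (#|S| %/ k) * volume S <= 4 * #|S| * volume T) \/
  exists A, [/\ A \subset S, A != set0 & {in A, forall x,
    volume S <= 4 * #|S| * degree_in A x /\ #|S| * degree_in A x <= k * volume S}].
Proof.
move=> k1 le_kS vol0; pose B := [set x in S | k * volume S < degree_in S x * #|S|].
have [/(exists_denser_subset k1 le_kS)|le_vol] := ltnP (2 * volume (S :\: B)) (volume S).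
  by left.
right; have [|A [ASB A0 A_min]] := @exists_min_degree_subset (S :\: B); first by lia.
have leSB : #|S :\: B| <= #|S| by apply/subset_leq_card/subsetDl.
have AS : A \subset S by apply: subset_trans ASB (subsetDl _ _).
exists A; split=> // x xA; have := subsetP ASB x xA; rewrite !inE => /andP[+ xS].
rewrite xS /= -leqNgt mulnC => deg_le; split; last first.
  by apply: leq_trans deg_le; rewrite leq_mul2l degree_inS ?orbT.
apply: leq_trans le_vol _; have := A_min x xA; nia.
Qed.

Lemma almost_regular_floor_degree k S A : let d := volume S %/ (4 * #|S|) in
  A \subset S -> 0 < d ->
  {in A, forall x, volume S <= 4 * #|S| * degree_in A x /\ #|S| * degree_in A x <= k * volume S} ->
  almost_regular (induced A) A d (8 * k).
Proof.
move=> d AS d0 A_deg; split=> [x y /and3P[]//|x xA]; have [deg_ge deg_le] := A_deg x xA.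
have S0 : 0 < #|S| by apply/card_gt0P; exists x; apply: (subsetP AS).
rewrite nbrs_induced // -/(degree_in A x); apply/andP; split.
  rewrite -(@leq_pmul2l (4 * #|S|)) ?muln_gt0 // (leq_trans _ deg_ge) //.
  by rewrite mulnC leq_divM.
rewrite -(leq_pmul2l S0) (leq_trans deg_le) //.
apply: (@leq_trans (k * (2 * (4 * #|S|) * d))); last by apply/eq_leq; lia.
by rewrite leq_mul2l leq_double_divn ?orbT.
Qed.
End Volume.

(* The choice of k makes the bound w ^ a <= C * (2 * m) ^ (a + b) self-improving. *)
Lemma leq_expn_denser a b k C s m v w : 0 < a -> 0 < b -> 2 ^ (3 * a + b) <= k -> 0 < m ->
  k * m <= s -> m * v <= 4 * s * w -> w ^ a <= C * (2 * m) ^ (a + b) -> v ^ a <= C * s ^ (a + b).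
Proof.
move=> a0 b0 le_k m0 le_kms le_v le_w.
have ma0 : 0 < m ^ a by rewrite expn_gt0 m0.
rewrite -(leq_pmul2l ma0) -expnMn; apply: (@leq_trans ((4 * s * w) ^ a)).
  by rewrite leq_exp2r.
rewrite expnMn; apply: (@leq_trans ((4 * s) ^ a * (C * (2 * m) ^ (a + b)))).
  by rewrite leq_mul2l le_w orbT.
have -> : (4 * s) ^ a * (C * (2 * m) ^ (a + b)) = m ^ a * (C * (s ^ a * (2 ^ (3 * a + b) * m ^ b))).
  have -> : 2 ^ (3 * a + b) = 4 ^ a * 2 ^ (a + b).
    by rewrite (_ : 3 * a + b = 2 * a + (a + b)) 1?expnD ?expnM //; lia.
  rewrite !expnMn (expnD m); move: (4 ^ a) (2 ^ (a + b)) (s ^ a) (m ^ a) (m ^ b).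
  by move=> x y z u w'; lia.
rewrite leq_mul2l (expnD s); apply/orP; right; rewrite leq_mul2l; apply/orP; right.
rewrite leq_mul2l; apply/orP; right; apply: (@leq_trans ((k * m) ^ b)); last by rewrite leq_exp2r.
rewrite expnMn leq_mul2r; apply/orP; right; apply: (leq_trans le_k).
by rewrite -[leqLHS]expn1 leq_pexp2l // (leq_trans _ le_k) // expn_gt0.
Qed.

Lemma volume_le_of_almost_regular a b : 0 < a -> 0 < b -> exists K, forall d0 C0, exists C,
  forall (V : finType) (e : rel V), symmetric e ->
    (forall (A : {set V}) d, A != set0 -> d0 <= d -> almost_regular (induced e A) A d K ->
      d ^ a <= C0 * #|A| ^ b) ->
    forall S : {set V}, volume e S ^ a <= C * #|S| ^ (a + b).
Proof.
move=> a0 b0; pose k := 4 * 2 ^ (3 * a + b).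
have k3 : 2 < k by rewrite (@leq_trans (4 * 1)) // leq_mul2l expn_gt0.
have k0 : 0 < k by exact: ltnW (ltnW k3).
exists (8 * k) => d0 C0; exists (k ^ a + (4 * d0.+1) ^ a + 8 ^ a * C0) => V e e_sym e_reg S.
set C := _ + _ + _; have [n] := ubnP #|S|; elim: n S => // n IHn S; rewrite ltnS => leSn.
set s := #|S| in leSn *; have [S0|s0] := posnP s.
  by rewrite /volume (cards0_eq S0) big_set0 exp0n.
have le_linear c : c ^ a <= C -> volume e S <= c * s -> volume e S ^ a <= C * s ^ (a + b).
  move=> le_cC le_vol; apply: (@leq_trans ((c * s) ^ a)); first by rewrite leq_exp2r.
  by rewrite expnMn leq_mul // leq_pexp2l // leq_addr.
have [lt_sk|le_ks] := ltnP s k.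
  apply: (le_linear k); first by rewrite /C -addnA leq_addr.
  by apply: leq_trans (volume_le_square e S) _; rewrite -mulnn leq_mul2r (ltnW lt_sk) orbT.
have [vol0|vol0] := posnP (volume e S).
  by rewrite vol0 exp0n.
have [[T leT volT]|] := denser_or_almost_regular e_sym (ltnW k3) le_ks vol0.
  have m0 : 0 < s %/ k by rewrite divn_gt0.
  have le_kms : k * (s %/ k) <= s by rewrite mulnC leq_divM.
  apply: (leq_expn_denser (k := k) a0 b0 _ m0 le_kms volT); first exact: leq_pmull.
  have lt_Tn : #|T| < n.
    by apply: leq_ltn_trans leT (leq_trans _ (leq_trans le_kms leSn)); rewrite ltn_pmul2r.
  by apply: leq_trans (IHn T lt_Tn) _; rewrite leq_mul2l leq_exp2r ?leT ?orbT // addn_gt0 a0.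
case=> A [AS A0 A_deg]; have leA : #|A| <= s by exact: subset_leq_card.
pose d := volume e S %/ (4 * s); have [le_dd0|lt_d0d] := ltnP d d0.+1.
  apply: (le_linear (4 * d0.+1)); first by rewrite /C addnAC leq_addl.
  have vol_lt : volume e S < d.+1 * (4 * s) by rewrite ltn_ceil // muln_gt0.
  by apply: leq_trans (ltnW vol_lt) _; rewrite mulnCA -mulnA leq_mul2l leq_mul2r le_dd0 !orbT.
have d_gt0 : 0 < d by exact: leq_ltn_trans lt_d0d.
have regA := almost_regular_floor_degree AS d_gt0 A_deg.
have le_da : d ^ a <= C0 * s ^ b.
  apply: leq_trans (e_reg A d A0 (ltnW lt_d0d) regA) _.
  by rewrite leq_mul2l leq_exp2r // leA orbT.
apply: (@leq_trans ((8 * s * d) ^ a)).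
  by rewrite leq_exp2r // (leq_trans (leq_double_divn d_gt0)) // !mulnA.
rewrite !expnMn; apply: leq_trans (leq_mul (leqnn _) le_da) _.
by rewrite expnD mulnACA leq_mul2r leq_addl orbT.
Qed.

Theorem ex_Tblowup_pow_le l : exists C, forall n, @ex n _ (@Tblowup l) ^ 7 <= C * n ^ 10.
Proof.
have [K volume_le] := volume_le_of_almost_regular (a := 7) (b := 3) isT isT.
have [C0 degree_le] := blowup_free_almost_regular l K.
have [C {}volume_le] := volume_le 32 C0; exists C => n; rewrite /ex.
elim/big_ind: _ => [|x y hx hy|E /containsP nembeds]; first by rewrite exp0n.
  by rewrite /maxn; case: ifP.
apply: leq_trans (_ : volume (adj E) [set: 'I_n] ^ 7 <= _).
  rewrite leq_exp2r // /volume /num_edges.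
  under [leqRHS]eq_bigr do rewrite /degree_in setIT.
  rewrite -(card_set_pair (mem [set: 'I_n]) (adj E)).
  by apply: subset_leq_card; apply/subsetP => -[x y]; rewrite !inE /= => /andP[].
rewrite -[n in leqRHS](card_ord n) -cardsT; apply: volume_le; first exact: adj_sym.
move=> A d A0 le32 regA; apply: (degree_le _ _ A d _ _ _ regA A0 le32).
- exact: (induced_sym (@adj_sym n E)).
- exact: (induced_irr (@adj_irr n E)).
- by apply: contra_not nembeds; apply: embeds_subrel => x y /and3P[].
Qed.

Import HB.structures all_algebra all_field ring mpoly.
Import GRing.Theory.
Local Open Scope ring_scope.

(** * Multivariate polynomials *)

Section MpolyRing.
Variables (R : comNzRingType) (n : nat).
Implicit Types (p q : {mpoly R[n]}) (z w : 'I_n -> R).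

Lemma mpoly_ring_ind (P : {mpoly R[n]} -> Prop) :
  (forall c, P c%:MP) -> (forall i, P 'X_i) ->
  (forall p q, P p -> P q -> P (p + q)) -> (forall p q, P p -> P q -> P (p * q)) ->
  forall p, P p.
Proof.
move=> PC PX PD PM p; rewrite [p]mpolyE.
apply: big_ind => [||m _]; [by rewrite -mpolyC0 | exact: PD |].
rewrite -mul_mpolyC; apply: (PM) => //; rewrite mpolyXE_id.
apply: big_ind => [||i _]; [by rewrite -mpolyC1 | exact: PM |].
elim: (m i) => [|d IHd]; first by rewrite expr0 -mpolyC1.
by rewrite exprS; apply: (PM).
Qed.

Lemma mderiv_map_mpoly (S : comNzRingType) (f : {rmorphism R -> S}) i p :
  (map_mpoly f p)^`M(i) = map_mpoly f p^`M(i).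
Proof.
apply/mpolyP => m.
by rewrite mcoeff_deriv !mcoeff_map_mpoly mcoeff_deriv raddfMn.
Qed.

Lemma meval_map_mpoly (S : comNzRingType) (f : {rmorphism R -> S}) (g : {rmorphism S -> R})
    (v : 'I_n -> S) p : cancel f g -> g (map_mpoly f p).@[v] = p.@[g \o v].
Proof.
move=> fK; elim/mpoly_ring_ind: p => [c|i|p q IHp IHq|p q IHp IHq].
- by rewrite map_mpolyC !mevalC fK.
- by rewrite map_mpolyX !mevalXU.
- by rewrite raddfD /= !mevalD rmorphD /= IHp IHq.
- by rewrite rmorphM /= !mevalM rmorphM /= IHp IHq.
Qed.

Definition dirder p z w : R := \sum_i w i * p^`M(i).@[z].

Lemma dirderC c z w : dirder c%:MP z w = 0.
Proof. by apply: big1 => i _; rewrite mderivC meval0 mulr0. Qed.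

Lemma dirderX i z w : dirder 'X_i z w = w i.
Proof.
rewrite /dirder (bigD1 i) //= big1 => [|j ji].
  by rewrite mderivX mnm1E eqxx scale1r -[X in 'X_[X - _]]add0m addmK mpolyX0 meval1 mulr1 addr0.
by rewrite mderivX mnm1E eq_sym (negPf ji) scale0r meval0 mulr0.
Qed.

Lemma dirderD p q z w : dirder (p + q) z w = dirder p z w + dirder q z w.
Proof. by rewrite -big_split /=; apply: eq_bigr => i _; rewrite mderivD mevalD mulrDr. Qed.

Lemma dirderB p q z w : dirder (p - q) z w = dirder p z w - dirder q z w.
Proof. by rewrite -sumrB; apply: eq_bigr => i _; rewrite mderivB mevalB mulrBr. Qed.

Lemma dirderZ c p z w : dirder (c *: p) z w = c * dirder p z w.
Proof. by rewrite /dirder big_distrr /=; apply: eq_bigr => i _; rewrite mderivZ mevalZ mulrCA. Qed.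

Lemma dirderM p q z w :
  dirder (p * q) z w = dirder p z w * q.@[z] + p.@[z] * dirder q z w.
Proof.
rewrite /dirder big_distrl big_distrr -big_split /=; apply: eq_bigr => i _.
by rewrite mderivM mevalD !mevalM; ring.
Qed.

Lemma dirder_scale p z w c : dirder p z (fun i => c * w i) = c * dirder p z w.
Proof. by rewrite /dirder big_distrr /=; apply: eq_bigr => i _; rewrite mulrA. Qed.

Lemma eq_dirder p z z' w w' : z =1 z' -> w =1 w' -> dirder p z w = dirder p z' w'.
Proof. by move=> eq_z eq_w; apply: eq_bigr => i _; rewrite eq_w (meval_eq _ eq_z). Qed.

Lemma meval_taylor p z w y : exists r,
  p.@[fun i => z i + y * w i] = p.@[z] + y * dirder p z w + y ^+ 2 * r.
Proof.
elim/mpoly_ring_ind: p => [c|i|p q [r Ep] [s Eq]|p q [r Ep] [s Eq]].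
- by exists 0; rewrite !mevalC dirderC; ring.
- by exists 0; rewrite !mevalXU dirderX; ring.
- by exists (r + s); rewrite !mevalD dirderD Ep Eq; ring.
exists (p.@[z] * s + r * q.@[z] + dirder p z w * dirder q z w
  + y * (dirder p z w * s + r * dirder q z w) + y ^+ 2 * (r * s)).
by rewrite !mevalM dirderM Ep Eq; ring.
Qed.
End MpolyRing.

Lemma dirder_comp (R : comNzRingType) n k (p : {mpoly R[n]}) (q : n.-tuple {mpoly R[k]})
    (z w : 'I_k -> R) :
  dirder (p \mPo q) z w =
    dirder p (fun i => (tnth q i).@[z]) (fun i => dirder (tnth q i) z w).
Proof.
elim/mpoly_ring_ind: p => [c|i|p p' IHp IHp'|p p' IHp IHp'].
- by rewrite comp_mpolyC !dirderC.
- by rewrite comp_mpolyXU -tnth_nth dirderX.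
- by rewrite comp_mpolyD !dirderD IHp IHp'.
- by rewrite rmorphM /= !dirderM IHp IHp' !comp_mpoly_meval.
Qed.

Section Degree.
Variables (R : idomainType) (n : nat).
Implicit Types p q : {mpoly R[n]}.

Lemma msizeM_leS p q a b : (msize p <= a.+1)%N -> (msize q <= b.+1)%N ->
  (msize (p * q) <= (a + b).+1)%N.
Proof.
move=> le_p le_q; have [->|p0] := eqVneq p 0; first by rewrite mul0r msize0.
have [->|q0] := eqVneq q 0; first by rewrite mulr0 msize0.
by rewrite msizeM //; move: le_p le_q; lia.
Qed.

Lemma msizeXn_leS p a d : (msize p <= a.+1)%N -> (msize (p ^+ d) <= (d * a).+1)%N.
Proof.
move=> le_p; elim: d => [|d IHd]; first by rewrite expr0 msize1.
by rewrite exprS mulSn; apply: msizeM_leS.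
Qed.

Lemma msize_prod_leS (I : finType) (F : I -> {mpoly R[n]}) (a : I -> nat) :
  (forall i, msize (F i) <= (a i).+1)%N -> (msize (\prod_i F i) <= (\sum_i a i).+1)%N.
Proof.
move=> le_F; elim/big_rec2: _ => [|i d p _ IHp]; first by rewrite msize1.
exact: msizeM_leS.
Qed.

Lemma msize_sum_le (I : finType) (F : I -> {mpoly R[n]}) a :
  (forall i, msize (F i) <= a)%N -> (msize (\sum_i F i) <= a)%N.
Proof.
by move=> le_F; apply: leq_trans (msize_sum _ _ _) _; apply/bigmax_leqP.
Qed.

Lemma msize_XsubC_le i c : (msize ('X_i - c%:MP : {mpoly R[n]}) <= 2)%N.
Proof.
apply: leq_trans (msizeD_le _ _) _; rewrite geq_max msizeX mdeg1 msizeN msizeC.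
by case: (c != 0).
Qed.

Lemma card_bmultinom_le d : (#|{: 'X_{1..n < d}}| <= d ^ n)%N.
Proof.
have lt_d (m : 'X_{1..n < d}) i : ((m : 'X_{1..n}) i < d)%N.
  by apply: leq_ltn_trans (bmdeg m); rewrite mdegE (bigD1 i) //= leq_addr.
pose f (m : 'X_{1..n < d}) := [ffun i : 'I_n => Ordinal (lt_d m i)].
have f_inj : injective f.
  move=> m m' /ffunP eq_f; apply/val_inj/mnmP => i.
  by have := eq_f i; rewrite !ffunE => /(congr1 val).
by have := leq_card f f_inj; rewrite card_ffun !card_ord.
Qed.
End Degree.

Lemma msize_comp_le (R : idomainType) n k (p : {mpoly R[n]}) (q : n.-tuple {mpoly R[k]}) d :
  (forall i, msize (tnth q i) <= 2)%N -> (msize p <= d.+1)%N -> (msize (p \mPo q) <= d.+1)%N.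
Proof.
move=> le_q le_p; rewrite (comp_mpolywE q le_p); apply: msize_sum_le => m.
apply: leq_trans (msizeZ_le _ _) _.
apply: leq_trans (msize_prod_leS (a := fun i => (m : 'X_{1..n}) i * 1)%N _) _.
  by move=> i; exact: msizeXn_leS.
by under eq_bigr do rewrite muln1; rewrite -mdegE; exact: bmdeg.
Qed.

Lemma mpoly_linear_dependence (F : fieldType) n (I : finType) (p : I -> {mpoly F[n]}) d :
  (forall x, msize (p x) <= d)%N -> (d ^ n < #|I|)%N ->
  exists2 c : I -> F, exists x, c x != 0 & \sum_x c x *: p x = 0.
Proof.
move=> le_p lt_I; pose J : finType := 'X_{1..n < d}.
pose M := \matrix_(x < #|I|, m < #|J|) (p (enum_val x))@_(val (enum_val m)).
have /rowV0Pn[v /sub_kermxP vM v0] : kermx M != 0.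
  rewrite -mxrank_eq0 mxrank_ker subn_eq0 -ltnNge.
  apply: leq_ltn_trans (rank_leq_col M) (leq_ltn_trans _ lt_I).
  exact: card_bmultinom_le.
exists (fun x => v 0 (enum_rank x)).
  have /rV0Pn[x vx] := v0.
  by exists (enum_val x); rewrite enum_valK.
apply/mpolyP => m; rewrite mcoeff0 raddf_sum /=.
under eq_bigr do rewrite mcoeffZ.
have [lt_md|le_dm] := ltnP (mdeg m) d; last first.
  apply: big1 => x _; rewrite (memN_msupp_eq0 (p := p x)) ?mulr0 //.
  by apply: msize_mdeg_ge; apply: leq_trans le_dm.
move/rowP/(_ (enum_rank (BMultinom lt_md : J))): vM; rewrite !mxE => {2}<-.
rewrite (reindex_onto enum_val enum_rank) => [|x _]; last by rewrite enum_rankK.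
apply: eq_big => [x|x _]; first by rewrite enum_valK eqxx.
by rewrite enum_valK mxE enum_rankK.
Qed.

(** * Nonsingular zeros of square systems *)

Definition eqmodX (R : comNzRingType) L (p q : {poly R}) : Prop := exists r, p = q + 'X^L * r.

Section EqmodX.
Variables (R : comNzRingType) (L : nat).
Implicit Types p q : {poly R}.

Lemma eqmodX_refl p : eqmodX L p p.
Proof. by exists 0; rewrite mulr0 addr0. Qed.

Lemma eqmodXM p p' q q' : eqmodX L p p' -> eqmodX L q q' -> eqmodX L (p * q) (p' * q').
Proof. by move=> [r ->] [s ->]; exists (p' * s + r * q' + 'X^L * (r * s)); ring. Qed.

Lemma eqmodX_exp p q n : eqmodX L p q -> eqmodX L (p ^+ n) (q ^+ n).
Proof.
move=> eq_pq; elim: n => [|n IHn]; first exact: eqmodX_refl.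
by rewrite !exprS; exact: eqmodXM.
Qed.

Lemma eqmodX_prod (I : finType) (p q : I -> {poly R}) :
  (forall i, eqmodX L (p i) (q i)) -> eqmodX L (\prod_i p i) (\prod_i q i).
Proof.
move=> eq_pq; apply: (big_ind2 (eqmodX L)) => [|p1 p2 q1 q2|i _]; first exact: eqmodX_refl.
  exact: eqmodXM.
exact: eq_pq.
Qed.

Lemma eqmodX_coef p q i : eqmodX L p q -> (i < L)%N -> p`_i = q`_i.
Proof. by case=> r -> lt_iL; rewrite coefD coefXnM lt_iL addr0. Qed.
End EqmodX.

Lemma horner0_dvd (F : fieldType) (p : {poly F}) : p.[0] = 0 -> exists q, p = 'X * q.
Proof.
move=> p0; have /factor_theorem[q ->] : root p 0 by apply/rootP.
by exists q; rewrite subr0 mulrC.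
Qed.

Lemma digits_inj k A (f g : 'I_k -> nat) :
  (forall i, f i < A)%N -> (forall i, g i < A)%N ->
  (\sum_i f i * A ^ i = \sum_i g i * A ^ i)%N -> f =1 g.
Proof.
elim: k f g => [|k IHk] f g ltf ltg; first by move=> _ [].
have split_digit (h : 'I_k.+1 -> nat) :
    (\sum_i h i * A ^ i = (\sum_(i < k) h (lift ord0 i) * A ^ i) * A + h ord0)%N.
  rewrite big_ord_recl expn0 muln1 addnC big_distrl /=; congr (_ + _)%N.
  by apply: eq_bigr => i _; rewrite /bump /= add1n expnSr mulnA.
have A0 : (0 < A)%N by apply: leq_ltn_trans (ltf ord0).
rewrite !split_digit => eq_sum.
have eq0 : f ord0 = g ord0 by have := congr1 (modn^~ A) eq_sum; rewrite !modnMDl !modn_small.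
move: eq_sum; rewrite eq0 => /addIn /eqP; rewrite eqn_mul2r eqn0Ngt A0 /= => /eqP eq_lift i.
have [j ->|->//] := unliftP ord0 i.
exact: (IHk (fun j => f (lift ord0 j)) (fun j => g (lift ord0 j))).
Qed.

Section Systems.
Variables (F : fieldType) (k : nat) (P : 'I_k -> {mpoly F[k]}).
Implicit Types a : 'I_k -> F.

Definition jacobian a : 'M[F]_k := \matrix_(i, j) ((P i)^`M(j)).@[a].

Definition nonsingular_zero a : Prop := (forall i, (P i).@[a] = 0) /\ jacobian a \in unitmx.

Local Notation arc_eval p Q := (map_mpoly (@polyC F) Q).@[p].

Lemma arc_eval_horner0 (p : 'I_k -> {poly F}) a (Q : {mpoly F[k]}) :
  (forall i, (p i).[0] = a i) -> (arc_eval p Q).[0] = Q.@[a].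
Proof.
move=> p0; rewrite -[LHS]/(horner_eval 0 _) meval_map_mpoly; first exact: meval_eq.
by move=> c; exact: hornerC.
Qed.

Lemma hensel_lift a (u : 'I_k -> {poly F}) L :
  nonsingular_zero a -> (forall i, (u i).[0] = 0) ->
  exists p : 'I_k -> {poly F}, (forall i, (p i).[0] = a i) /\
    (forall i, eqmodX L.+1 (arc_eval p (P i)) (u i)).
Proof.
move=> [Pa Ja] u0; elim: L => [|L [p [pa /fin_all_exists[r Er]]]].
  exists (fun i => (a i)%:P); split=> i; first by rewrite hornerC.
  have [|q Eq] := @horner0_dvd _ (arc_eval (fun i => (a i)%:P) (P i) - u i).
    by rewrite hornerD hornerN u0 subr0 (@arc_eval_horner0 _ a) // => j; rewrite hornerC.
  by exists q; rewrite expr1 -Eq addrC subrK.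
pose w := invmx (jacobian a) *m \col_i - (r i).[0].
have Ew i : \sum_j w j 0 * ((P i)^`M(j)).@[a] = - (r i).[0].
  have : (jacobian a *m w) i 0 = (\col_i - (r i).[0]) i 0 by rewrite mulKVmx.
  by rewrite !mxE => <-; apply: eq_bigr => j _; rewrite [jacobian a _ _]mxE mulrC.
exists (fun i => p i + 'X^(L.+1) * (w i 0)%:P); split=> i.
  by rewrite hornerD hornerM hornerXn expr0n mul0r addr0.
set P' := map_mpoly (@polyC F) (P i).
have [s ->] := meval_taylor P' p (fun i => (w i 0)%:P) 'X^(L.+1).
have [|q Eq] := @horner0_dvd _ (r i + dirder P' p (fun i => (w i 0)%:P)).
  rewrite hornerD horner_sum -[(r i).[0]]opprK -Ew addrC; apply/eqP; rewrite subr_eq0; apply/eqP.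
  by apply: eq_bigr => j _; rewrite hornerM hornerC mderiv_map_mpoly (arc_eval_horner0 _ pa).
exists (q + 'X^L * s); rewrite Er mulrDr [_ ^+ L.+2]exprSr -[in RHS]mulrA -Eq.
by rewrite !exprSr; ring.
Qed.

Section CoordinateRelation.
Variables (A : nat) (c : 'I_k).
Local Notation exponents := {ffun 'I_k -> 'I_A}.
Implicit Types (g : exponents) (lam : exponents * 'I_A -> F).

Definition digit_sum g : nat := (\sum_i g i * A ^ i)%N.

Definition coordinate_relation lam : Prop :=
  \sum_x lam x *: (\prod_i P i ^+ x.1 i * 'X_c ^+ x.2) = 0.

Lemma digit_sum_inj : injective digit_sum.
Proof.
move=> g g'; rewrite /digit_sum => eq_sum; apply/ffunP => i; apply: val_inj.
by apply: (digits_inj _ _ eq_sum) => j; exact: ltn_ord.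
Qed.

(* Along an arc with P_i = X^(A^i) the term indexed by (g, b) has order digit_sum g, so
   the terms with the least exponent vector have to cancel among themselves. *)
Lemma coordinate_relation_lowest lam g a :
  coordinate_relation lam -> nonsingular_zero a ->
  (forall g' b, (digit_sum g' < digit_sum g)%N -> lam (g', b) = 0) ->
  \sum_b lam (g, b) * a c ^+ b = 0.
Proof.
move=> rel_lam za g_low.
have [|p [pa p_lift]] := @hensel_lift a (fun i => 'X^(A ^ i)) (digit_sum g) za.
  by move=> i; rewrite hornerXn expr0n expn_eq0 (gtn_eqF (leq_ltn_trans _ (ltn_ord (g i)))).
have := congr1 (fun Q => (arc_eval p Q)`_(digit_sum g)) rel_lam.
rewrite raddf0 meval0 coef0 (raddf_sum (map_mpoly _)) (raddf_sum (meval p)) coef_sum /=.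
rewrite (eq_bigr (fun x => lam (x.1, x.2) * ('X^(digit_sum x.1) * p c ^+ x.2)`_(digit_sum g)));
  last first.
  move=> x _; rewrite map_mpolyZ mevalZ coefCM -surjective_pairing; congr (_ * _).
  rewrite rmorphM rmorph_prod rmorphXn /= map_mpolyX mevalM rmorphXn /= mevalXU rmorph_prod /=.
  apply: (eqmodX_coef (L := (digit_sum g).+1)) (ltnSn _); apply: eqmodXM (eqmodX_refl _ _).
  have -> : 'X^(digit_sum x.1) = \prod_(i < k) 'X^(A ^ i) ^+ x.1 i :> {poly F}.
    by rewrite /digit_sum -prodrXr; apply: eq_bigr => i _; rewrite -exprM mulnC.
  apply: eqmodX_prod => i; rewrite (rmorphXn (map_mpoly _)) (rmorphXn (meval p)).
  exact: eqmodX_exp (p_lift i).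
rewrite -(pair_bigA _ (fun g' b => lam (g', b) * ('X^(digit_sum g') * p c ^+ b)`_(digit_sum g))).
rewrite (bigD1 g) //= [X in _ + X]big1 ?addr0 => [sum0|g' neq_g'g].
  rewrite -[RHS]sum0; apply: eq_bigr => b _.
  by rewrite coefXnM ltnn subnn -horner_coef0 horner_exp pa.
apply: big1 => b _; case: (ltngtP (digit_sum g') (digit_sum g)) => [lt_g'|gt_g'|eq_g'].
- by rewrite g_low // mul0r.
- by rewrite coefXnM gt_g' mulr0.
- by rewrite (digit_sum_inj eq_g') eqxx in neq_g'g.
Qed.
End CoordinateRelation.

Section DegreeBound.
Variable D : nat.
Hypothesis sizeP : forall i, (msize (P i) <= D.+1)%N.
Local Notation A := ((k * D + 2) ^ k).+1.

Lemma exists_coordinate_relation c : exists2 lam : {ffun 'I_k -> 'I_A} * 'I_A -> F,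
  exists x, lam x != 0 & coordinate_relation c lam.
Proof.
apply: (mpoly_linear_dependence (d := ((k * D + 2) * A)%N)) => [[g b] /=|].
  have size_prod : (msize (\prod_i P i ^+ g i) <= (\sum_(i < k) (A.-1 * D)).+1)%N.
    apply: msize_prod_leS => i; apply: leq_trans (msizeXn_leS _ (sizeP i)) _.
    by rewrite ltnS leq_mul2r; apply/orP; right; exact: (ltn_ord (g i)).
  have size_Xc : (msize ('X_c ^+ b : {mpoly F[k]}) <= (b * 1).+1)%N.
    by apply: msizeXn_leS; rewrite msizeX mdeg1.
  apply: leq_trans (msizeM_leS size_prod size_Xc) _; rewrite sum_nat_const card_ord.
  by have := ltn_ord b; have : (0 < A)%N by []; nia.
by rewrite card_prod card_ffun !card_ord expnMn mulnC ltn_pmul2l ?expn_gt0.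
Qed.

Lemma exists_coordinate_poly c : exists R : {poly F}, [/\ R != 0, (size R <= A)%N &
  forall a, nonsingular_zero a -> root R (a c)].
Proof.
have [lam [[g0 b0] lam0] rel_lam] := exists_coordinate_relation c.
pose occurs := [pred g | [exists b, lam (g, b) != 0]].
have g0_occurs : occurs g0 by apply/existsP; exists b0.
case: (arg_minnP (@digit_sum A) g0_occurs) => g /existsP[b lam_gb] g_min.
exists (\poly_(i < A) lam (g, inord i)); split; last 2 first.
- exact: size_poly.
- move=> a za; apply/rootP; rewrite horner_poly.
  rewrite -[RHS](coordinate_relation_lowest (g := g) rel_lam za).
    by apply: eq_bigr => i _; rewrite inord_val.
  move=> g' b'; apply: contraTeq => lam_g'; rewrite -leqNgt; apply: g_min.
  by apply/existsP; exists b'.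
apply: contraNneq lam_gb => /(congr1 (fun R : {poly F} => R`_b)).
by rewrite coef0 coef_poly ltn_ord inord_val => ->.
Qed.
End DegreeBound.
End Systems.

Definition zero_bound k D : nat := (((k * D + 2) ^ k).+1 ^ k)%N.

Lemma card_nonsingular_zeros (F : finFieldType) k (P : 'I_k -> {mpoly F[k]}) D
    (S : {set {ffun 'I_k -> F}}) :
  (forall i, msize (P i) <= D.+1)%N -> (forall a, a \in S -> nonsingular_zero P a) ->
  (#|S| <= zero_bound k D)%N.
Proof.
move=> sizeP zS; rewrite /zero_bound; set A := _.+1.
have /fin_all_exists[R R_coord] := exists_coordinate_poly sizeP.
apply: (@leq_trans #|family (fun c => [pred z | root (R c) z])|).
  apply: subset_leq_card; apply/subsetP => a /zS za.
  by apply/familyP => c; have [_ _] := R_coord c; apply.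
rewrite card_family foldrE big_map big_enum /=.
apply: (@leq_trans (\prod_(c < k) A)); last by rewrite prod_nat_const card_ord.
apply: leq_prod => c _; have [R0 le_R _] := R_coord c; apply: leq_trans le_R.
rewrite cardE ltnW // max_poly_roots ?enum_uniq //.
by apply/allP => z; rewrite mem_enum.
Qed.

Lemma card_jacobian_kernel_ge (F : finFieldType) k (P : 'I_k -> {mpoly F[k]}) (a : 'I_k -> F) :
  jacobian P a \notin unitmx ->
  (#|F| <= #|[set x : {ffun 'I_k -> F} | [forall i, dirder (P i) a x == 0%R]]|)%N.
Proof.
move=> singular; have /rowV0Pn[x /sub_kermxP xJ /rV0Pn[j xj0]] : kermx (jacobian P a)^T != 0.
  by rewrite kermx_eq0 row_free_unit unitmx_tr.
pose f c := [ffun i => c * x 0 i].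
have f_inj : injective f by move=> c c' /ffunP/(_ j); rewrite !ffunE => /(mulIf xj0).
rewrite -cardsT -(card_imset _ f_inj); apply: subset_leq_card; apply/subsetP => _ /imsetP[c _ ->].
rewrite inE; apply/forallP => i.
rewrite (@eq_dirder _ _ _ _ a _ (fun j => c * x 0 j)) // => [|j']; last by rewrite ffunE.
rewrite dirder_scale mulf_eq0; apply/orP; right; move/rowP/(_ i): xJ; rewrite !mxE => <-.
by apply/eqP/eq_bigr => j' _; rewrite !mxE.
Qed.

(** * Random polynomials *)

Lemma card_common_kernel (F : finFieldType) (V : finLmodType F) (I : finType)
    (phi : I -> V -> F) (b : I -> V) :
  (forall i, scalar (phi i)) -> (forall i j, phi i (b j) = (i == j)%:R) ->
  (#|[set v | [forall i, phi i v == 0%R]]| * #|F| ^ #|I| = #|V|)%N.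
Proof.
move=> phi_lin phi_b; set K := [set v | _].
have [f fE] : exists f : I -> {scalar V}, forall i, f i =1 phi i.
  pose f i : {scalar V} := HB.pack (phi i) (GRing.isLinear.Build F V F *%R (phi i) (phi_lin i)).
  by exists f.
pose comb (a : {ffun I -> F}) : V := \sum_j a j *: b j.
have f_comb a i : f i (comb a) = a i.
  rewrite raddf_sum (bigD1 i) //= scalarZ fE phi_b eqxx mulr1 big1 ?addr0 // => j ji.
  by rewrite scalarZ fE phi_b eq_sym (negPf ji) mulr0.
pose h (x : V * {ffun I -> F}) := x.1 + comb x.2.
have h_inj : {in setX K setT &, injective h}.
  move=> [v a] [v' a']; rewrite !inE !andbT => /forallP Kv /forallP Kv' eq_h.
  have eq_a : a = a'.
    apply/ffunP => i; have := congr1 (f i) eq_h; rewrite !raddfD /= !f_comb !fE.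
    by rewrite (eqP (Kv i)) (eqP (Kv' i)) !add0r.
  by move: eq_h; rewrite /h eq_a => /addIr /= ->.
rewrite -card_ffun -cardsT -cardsX -(card_in_imset h_inj) -cardsT; congr #|pred_of_set _|.
apply/setP => v; rewrite inE; apply/imsetP; pose a := [ffun i => phi i v].
exists (v - comb a, a); last by rewrite /h subrK.
rewrite !inE andbT; apply/forallP => i.
by rewrite -fE raddfB /= f_comb ffunE fE subrr.
Qed.

Section BoundedDegree.
Variables (F : finFieldType) (m D : nat).
Local Notation monomials := 'X_{1..m < D}.
Local Notation coefs := 'rV[F]_#|{: monomials}|.

Definition poly_of (c : coefs) : {mpoly F[m]} :=
  \sum_(i < #|{: monomials}|) c 0 i *: 'X_[bmnm (enum_val i)].

Lemma poly_of_is_linear : linear poly_of.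
Proof.
move=> a c c'; rewrite scaler_sumr -big_split; apply: eq_bigr => i _ /=.
by rewrite !mxE scalerDl scalerA.
Qed.

HB.instance Definition _ :=
  GRing.isLinear.Build F coefs {mpoly F[m]} *:%R poly_of poly_of_is_linear.

Lemma msize_poly_of c : (msize (poly_of c) <= D)%N.
Proof.
apply: msize_sum_le => i; apply: leq_trans (msizeZ_le _ _) _.
by rewrite msizeX; exact: bmdeg.
Qed.

Lemma poly_of_surj (p : {mpoly F[m]}) : (msize p <= D)%N -> exists c, poly_of c = p.
Proof.
move=> le_p; exists (\row_i p@_(bmnm (enum_val i))).
rewrite [RHS](mpolywE le_p) (reindex_onto enum_val enum_rank) => [|mu _]; last first.
  by rewrite enum_rankK.
apply: eq_big => [i|i _]; first by rewrite enum_valK eqxx.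
by rewrite mxE.
Qed.

Section Jets.
Variables (E : finType) (z w : E -> {ffun 'I_m -> F}).
Hypothesis z_inj : injective z.

Lemma exists_bump e : exists p : {mpoly F[m]}, [/\ (msize p <= (2 * #|E|).+1)%N, p.@[z e] = 1 &
  forall e', e' != e -> p.@[z e'] = 0 /\ forall v, dirder p (z e') v = 0].
Proof.
have /fin_all_exists[p hp] : forall e', exists p : {mpoly F[m]},
    [/\ (msize p <= 2.+1)%N, p.@[z e] = 1 &
      e' != e -> p.@[z e'] = 0 /\ forall v, dirder p (z e') v = 0].
  move=> e'; have [->|neq_e] := eqVneq e' e.
    by exists 1; split; rewrite ?msize1 ?meval1.
  have [c neq_c] : exists c, z e c != z e' c.
    apply/existsP; apply: contraNT neq_e => /existsPn eq_z; apply/eqP/z_inj/ffunP => c.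
    by apply/eqP; rewrite eq_sym; have := eq_z c; rewrite negbK.
  pose L := (z e c - z e' c)^-1 *: ('X_c - (z e' c)%:MP).
  have evalL (x : 'I_m -> F) : L.@[x] = (z e c - z e' c)^-1 * (x c - z e' c).
    by rewrite mevalZ mevalB mevalXU mevalC.
  exists (L ^+ 2); split.
  - by apply: (msizeXn_leS (a := 1)); apply: leq_trans (msizeZ_le _ _) (msize_XsubC_le _ _).
  - by rewrite expr2 mevalM evalL mulVf ?mulr1 // subr_eq0.
  - by move=> _; split=> [|v]; rewrite expr2 ?dirderM ?mevalM evalL subrr; ring.
exists (\prod_e' p e'); split.
- apply: leq_trans (msize_prod_leS (a := fun=> 2) _) _; first by move=> e'; have [] := hp e'.
  by rewrite sum_nat_const mulnC.
- by rewrite rmorph_prod /= big1 // => e' _; have [] := hp e'.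
move=> e' neq_e; have [_ _ /(_ neq_e)[p0 dp0]] := hp e'.
by split=> [|v]; rewrite (bigD1 e') //= ?mevalM ?dirderM p0 ?dp0 !mul0r ?addr0.
Qed.

Lemma exists_dual_dirder e : w e != 0 -> exists p : {mpoly F[m]},
  [/\ (msize p <= (2 * #|E|).+2)%N, forall e', p.@[z e'] = 0 &
    forall e', dirder p (z e') (w e') = (e' == e)%:R].
Proof.
move=> we0; have [i wi0] : exists i, w e i != 0.
  apply/existsP; apply: contraNT we0 => /existsPn wi0; apply/eqP/ffunP => i.
  by rewrite ffunE; apply/eqP; have := wi0 i; rewrite negbK.
have [p [le_p p1 p0]] := exists_bump e.
exists (p * ((w e i)^-1 *: ('X_i - (z e i)%:MP))); split.
- rewrite -[(2 * #|E|).+2]addn1; apply: msizeM_leS => //.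
  exact: leq_trans (msizeZ_le _ _) (msize_XsubC_le _ _).
- move=> e'; rewrite mevalM mevalZ mevalB mevalXU mevalC.
  by have [->|/p0[-> _]] := eqVneq e' e; rewrite ?subrr ?mulr0 ?mul0r.
move=> e'; rewrite dirderM dirderZ dirderB dirderX dirderC subr0 mevalZ mevalB mevalXU mevalC.
have [->|/p0[-> ->]] := eqVneq e' e; last by rewrite !mul0r addr0.
by rewrite p1 subrr !mulr0 add0r mul1r mulVf.
Qed.

Lemma exists_dual_value e : exists p : {mpoly F[m]}, [/\ (msize p <= (2 * #|E|).+2)%N,
  forall e', p.@[z e'] = (e' == e)%:R & forall e', dirder p (z e') (w e') = 0].
Proof.
have [p [le_p p1 p0]] := exists_bump e.
have evalp e' : p.@[z e'] = (e' == e)%:R by have [->|/p0[]//] := eqVneq e' e.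
have [we0|/exists_dual_dirder[b [le_b b0 db]]] := eqVneq (w e) 0.
  exists p; split=> // [|e']; first exact: leqW.
  have [->|/p0[]//] := eqVneq e' e.
  by apply: big1 => i _; rewrite we0 ffunE mul0r.
exists (p + (- dirder p (z e) (w e)) *: b); split.
- apply: leq_trans (msizeD_le _ _) _; rewrite geq_max leqW //.
  exact: leq_trans (msizeZ_le _ _) le_b.
- by move=> e'; rewrite mevalD mevalZ b0 mulr0 addr0.
move=> e'; rewrite dirderD dirderZ db; have [->|/p0[_ ->]] := eqVneq e' e.
  by rewrite mulr1 subrr.
by rewrite mulr0 addr0.
Qed.

Lemma card_vanishing_jets : ((2 * #|E|).+2 <= D)%N ->
  (#|[set c | [forall e, ((poly_of c).@[z e] == 0%R) && (dirder (poly_of c) (z e) (w e) == 0%R)]]|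
    * #|F| ^ (#|E| + #|[set e | w e != 0%R]|) = #|{: coefs}|)%N.
Proof.
move=> le_D; pose I : finType := (E + {e | w e != 0})%type.
pose phi (x : I) (c : coefs) : F := match x with
  | inl e => (poly_of c).@[z e] | inr e => dirder (poly_of c) (z (val e)) (w (val e)) end.
have phi_lin x : scalar (phi x).
  by move=> a c c'; case: x => e; rewrite /= linearP /= ?mevalD ?mevalZ ?dirderD ?dirderZ.
have /fin_all_exists[b phi_b] : forall x : I, exists b : coefs, forall y, phi y b = (y == x)%:R.
  case=> [e|[e we0]].
    have [p [le_p p1 dp0]] := exists_dual_value e.
    have [c Ec] := poly_of_surj (leq_trans le_p le_D).
    by exists c => -[e'|e'] /=; rewrite Ec ?p1 ?dp0.
  have [p [le_p p0 dp1]] := exists_dual_dirder we0.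
  have [c Ec] := poly_of_surj (leq_trans le_p le_D).
  by exists c => -[e'|e'] /=; rewrite Ec ?p0 ?dp1.
have cardI : #|I| = (#|E| + #|[set e | w e != 0%R]|)%N by rewrite card_sum card_sig cardsE.
rewrite -cardI -(card_common_kernel phi_lin (fun x y => phi_b y x)); congr (_ * _)%N.
apply: eq_card => c; rewrite !inE.
apply/forallP/forallP => [jet0 [e|e]|phi0 e].
- by have /andP[] := jet0 e.
- by have /andP[] := jet0 (val e).
rewrite (phi0 (inl e)) /=; have [we0|we0] := eqVneq (w e) 0; last exact: (phi0 (inr (Sub e we0))).
by apply/eqP/big1 => i _; rewrite we0 ffunE mul0r.
Qed.
End Jets.

Lemma card_vanishing (z : {ffun 'I_m -> F}) : (0 < D)%N ->
  (#|[set c | (poly_of c).@[z] == 0%R]| * #|F| = #|{: coefs}|)%N.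
Proof.
move=> D0; have [c0 Ec0] : exists c0, poly_of c0 = 1 by apply: poly_of_surj; rewrite msize1.
rewrite -(@card_common_kernel F _ unit (fun _ c => (poly_of c).@[z]) (fun=> c0)).
- rewrite card_unit expn1; congr (_ * _)%N; apply: eq_card => c; rewrite !inE.
  by apply/eqP/forallP => [-> []|/(_ tt)/eqP].
- by move=> _ a c c'; rewrite linearP /= mevalD mevalZ.
- by move=> [] []; rewrite Ec0 meval1.
Qed.
End BoundedDegree.

(** * Random algebraic graphs *)

(* A rooted bipartite graph with root set Rt, remaining vertex set Pv and edge set E; the edge e
   joins xs e in the first vertex class to ys e in the second. A host vertex is a point of F^E,
   and a point x is joined to a point y when #|Pv| polynomials vanish at (x, y). *)
Section AlgebraicGraph.
Variables (Rt Pv E : finType) (xs ys : E -> Rt + Pv) (F : finFieldType) (d : nat).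
Local Notation U := {ffun E -> F}.
Local Notation m := #|{: E + E}|.
Local Notation coefs := 'rV[F]_#|{: 'X_{1..m < d.+1}}|.
Local Notation Om := {ffun Pv -> coefs}.
Implicit Types (x y : U) (r : {ffun Rt -> U}) (v u : {ffun Pv -> U}) (om : Om).

Definition join x y : {ffun 'I_m -> F} :=
  [ffun c => match enum_val c with inl i => x i | inr i => y i end].

Lemma join_inj x y x' y' : join x y = join x' y' -> x = x' /\ y = y'.
Proof.
move/ffunP=> eq_join; split; apply/ffunP => i.
  by have := eq_join (enum_rank (inl i)); rewrite !ffunE enum_rankK.
by have := eq_join (enum_rank (inr i)); rewrite !ffunE enum_rankK.
Qed.

Lemma join_eq0 x y : (join x y == 0) = (x == 0) && (y == 0).
Proof.
have join00 : join 0 0 = 0 by apply/ffunP => c; rewrite !ffunE; case: enum_val => i; rewrite ffunE.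
apply/eqP/andP => [|[/eqP-> /eqP->]//].
by rewrite -join00 => /join_inj[-> ->].
Qed.

Definition host_edge om x y : bool := [forall h, (poly_of (om h)).@[join x y] == 0].

Definition at_slot r v (sl : Rt + Pv) : U := match sl with inl i => r i | inr i => v i end.

Definition edge_point r v e := join (at_slot r v (xs e)) (at_slot r v (ys e)).

Definition hosted om r v : bool :=
  [forall e, host_edge om (at_slot r v (xs e)) (at_slot r v (ys e))].

Definition tangent om r v : {set {ffun Pv -> U}} :=
  [set u | [forall h, forall e,
    dirder (poly_of (om h)) (edge_point r v e) (edge_point 0 u e) == 0]].

Section CopySystem.
Variables (om : Om) (r : {ffun Rt -> U}).
Local Notation k := #|{: Pv * E}|.

Definition encode v : {ffun 'I_k -> F} := [ffun j => v (enum_val j).1 (enum_val j).2].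

Definition decode (a : {ffun 'I_k -> F}) : {ffun Pv -> U} :=
  [ffun i => [ffun e => a (enum_rank (i, e))]].

Definition slot_poly (sl : Rt + Pv) (i : E) : {mpoly F[k]} :=
  match sl with inl h => (r h i)%:MP | inr h => 'X_(enum_rank (h, i)) end.

Definition edge_poly e : m.-tuple {mpoly F[k]} :=
  [tuple match enum_val c with inl i => slot_poly (xs e) i | inr i => slot_poly (ys e) i end
    | c < m].

Definition copy_system (i : 'I_k) : {mpoly F[k]} :=
  poly_of (om (enum_val i).1) \mPo edge_poly (enum_val i).2.

Lemma encodeK : cancel encode decode.
Proof. by move=> v; apply/ffunP => i; apply/ffunP => e; rewrite !ffunE enum_rankK. Qed.

Lemma decodeK : cancel decode encode.
Proof. by move=> a; apply/ffunP => j; rewrite !ffunE -surjective_pairing enum_valK. Qed.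

Lemma edge_poly_meval v e c : (tnth (edge_poly e) c).@[encode v] = edge_point r v e c.
Proof.
rewrite tnth_mktuple ffunE; case: (enum_val c) => i; [case: (xs e)|case: (ys e)] => h /=;
  by rewrite ?mevalC // mevalXU ffunE enum_rankK.
Qed.

Lemma edge_poly_dirder v u e c :
  dirder (tnth (edge_poly e) c) (encode v) (encode u) = edge_point 0 u e c.
Proof.
rewrite tnth_mktuple ffunE; case: (enum_val c) => i; [case: (xs e)|case: (ys e)] => h /=;
  by rewrite ?dirderC ?ffunE ?ffunE // dirderX ffunE enum_rankK.
Qed.

Lemma copy_system_meval v i : (copy_system i).@[encode v] =
  (poly_of (om (enum_val i).1)).@[edge_point r v (enum_val i).2].
Proof. by rewrite comp_mpoly_meval; apply: meval_eq => c; exact: edge_poly_meval. Qed.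

Lemma copy_system_dirder v u i : dirder (copy_system i) (encode v) (encode u) =
  dirder (poly_of (om (enum_val i).1)) (edge_point r v (enum_val i).2)
    (edge_point 0 u (enum_val i).2).
Proof.
by rewrite dirder_comp; apply: eq_dirder => c; [exact: edge_poly_meval|exact: edge_poly_dirder].
Qed.

Lemma msize_copy_system i : (msize (copy_system i) <= d.+1)%N.
Proof.
apply: msize_comp_le (msize_poly_of _) => c; rewrite tnth_mktuple.
case: (enum_val c) => j; [case: (xs _)|case: (ys _)] => h /=; rewrite ?msizeX ?mdeg1 // msizeC;
  by case: (_ != _).
Qed.

Lemma nonsingular_zero_copy v : hosted om r v -> (#|tangent om r v| < #|F|)%N ->
  nonsingular_zero copy_system (encode v).
Proof.
move=> /forallP v_hosted; rewrite ltnNge => few_tangents; split=> [i|].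
  by rewrite copy_system_meval; have /forallP/(_ (enum_val i).1)/eqP := v_hosted (enum_val i).2.
apply: contraNT few_tangents => /card_jacobian_kernel_ge/leq_trans; apply.
rewrite -(card_imset _ (can_inj encodeK)); apply: subset_leq_card; apply/subsetP => a.
rewrite inE => /forallP a0; rewrite -[a]decodeK imset_f // inE.
apply/forallP => h; apply/forallP => e; have := a0 (enum_rank (h, e)).
by rewrite -{1}[a]decodeK copy_system_dirder enum_rankK.
Qed.

Lemma card_nonsingular_copies :
  (#|[set v | hosted om r v && (#|tangent om r v| < #|F|)]| <= zero_bound k d)%N.
Proof.
rewrite -(card_imset _ (can_inj encodeK)).
apply: (card_nonsingular_zeros msize_copy_system) => _ /imsetP[v + ->].
by rewrite inE => /andP[]; exact: nonsingular_zero_copy.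
Qed.
End CopySystem.

Definition touches (S : {set Pv}) e : bool :=
  let touched sl := if sl is inr i then i \in S else false in touched (xs e) || touched (ys e).

Definition moved u : {set Pv} := [set i | u i != 0].

Lemma edge_point_tangent_neq0 u e : (edge_point 0 u e != 0) = touches (moved u) e.
Proof.
rewrite join_eq0 negb_and /touches.
by case: (xs e) => h; case: (ys e) => h'; rewrite /= ?inE ?ffunE ?eqxx.
Qed.

Section Singular.
Variable s : nat.
Implicit Types (V W : {ffun 'I_s -> {ffun Pv -> U}}).

Definition distinct_edges r V : bool :=
  injectiveb (fun p : 'I_s * E => edge_point r (V p.1) p.2).

Definition singular_family om r V : bool :=
  distinct_edges r V && [forall j, hosted om r (V j) && (#|F| <= #|tangent om r (V j)|)%N].

Definition tangent_family r V W : {set Om} :=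
  [set om | [forall j, hosted om r (V j) && (W j \in tangent om r (V j))]].

Hypothesis le_d : ((2 * (s * #|E|)).+2 <= d.+1)%N.

Lemma card_tangent_family r V W : distinct_edges r V ->
  (#|tangent_family r V W| *
    #|F| ^ (#|Pv| * (s * #|E| + \sum_j #|[set e | touches (moved (W j)) e]|)) = #|{: Om}|)%N.
Proof.
move=> /injectiveP points_inj; pose z (p : 'I_s * E) := edge_point r (V p.1) p.2.
pose w (p : 'I_s * E) := edge_point 0 (W p.1) p.2.
pose C := [set c : coefs |
  [forall p, ((poly_of c).@[z p] == 0) && (dirder (poly_of c) (z p) (w p) == 0)]].
have cardE : #|{: 'I_s * E}| = (s * #|E|)%N by rewrite card_prod card_ord.
have -> : #|tangent_family r V W| = (#|C| ^ #|Pv|)%N.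
  rewrite -card_ffun_on; apply: eq_card => om; rewrite inE.
  apply/forallP/ffun_onP => [om_jet h|om_jet j].
    rewrite inE; apply/forallP => -[j e].
    have /andP[/forallP/(_ e)/forallP/(_ h) hosted_e] := om_jet j.
    by rewrite inE => /forallP/(_ h)/forallP/(_ e) ->; rewrite andbT.
  have om_jet' h e : (poly_of (om h)).@[z (j, e)] == 0 /\
      dirder (poly_of (om h)) (z (j, e)) (w (j, e)) == 0.
    by apply/andP; have := om_jet h; rewrite inE => /forallP.
  apply/andP; split; first by apply/forallP => e; apply/forallP => h; case: (om_jet' h e).
  by rewrite inE; apply/forallP => h; apply/forallP => e; case: (om_jet' h e).
have -> : (\sum_j #|[set e | touches (moved (W j)) e]| = #|[set p | w p != 0%R]|)%N.
  rewrite -(card_set_pair 'I_s (fun j e => touches (moved (W j)) e)).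
  by apply: eq_card => p; rewrite !inE edge_point_tangent_neq0.
rewrite [(#|Pv| * _)%N]mulnC expnM -expnMn -cardE card_vanishing_jets ?cardE //.
by rewrite [RHS]card_ffun.
Qed.

Definition balanced : Prop :=
  forall S : {set Pv}, (#|E| * #|S| <= #|Pv| * #|[set e | touches S e]|)%N.

Hypothesis xs_ys_balanced : balanced.

Lemma card_tangent_family_le r V W : distinct_edges r V ->
  (#|tangent_family r V W| * #|F| ^ (#|Pv| * #|E| * s) * #|{: U}| ^ (#|Pv| * s) <=
    #|{: Om}| * \prod_j \prod_i (if W j i == 0%R then #|{: U}| else 1))%N.
Proof.
move=> points_inj.
have -> : (\prod_j \prod_i (if W j i == 0%R then #|{: U}| else 1) =
    #|{: U}| ^ (\sum_j #|~: moved (W j)|))%N.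
  rewrite expn_sum; apply: eq_bigr => j _; rewrite -big_mkcond prod_nat_const.
  by congr (_ ^ _)%N; apply: eq_card => i; rewrite !inE negbK.
have -> : (#|Pv| * s = \sum_j #|moved (W j)| + \sum_j #|~: moved (W j)|)%N.
  rewrite -big_split (eq_bigr (fun=> #|Pv|)) => [|j _]; last by rewrite /= cardsC.
  by rewrite sum_nat_const card_ord mulnC.
rewrite expnD mulnA leq_mul2r -(card_tangent_family W points_inj); apply/orP; right.
rewrite -mulnA leq_mul2l card_ffun -expnM -expnD leq_exp2l ?card_finNzRing_gt1 //.
apply/orP; right; rewrite mulnDr -mulnA (mulnC #|E| s) leq_add2l.
by rewrite !big_distrr; apply: leq_sum => j _; exact: xs_ys_balanced.
Qed.

(* Each singular family is counted at least #|F| ^ s times by its families of tangent vectors. *)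
Lemma card_singular_family_le r V :
  (#|[set om | singular_family om r V]| * #|F| ^ s * #|F| ^ (#|Pv| * #|E| * s) <=
    2 ^ (#|Pv| * s) * #|{: Om}|)%N.
Proof.
have [points_inj|not_inj] := boolP (distinct_edges r V); last first.
  by rewrite eq_card0 // => om; rewrite inE /singular_family (negPf not_inj).
set B := [set om | _].
have le_B : (#|B| * #|F| ^ s <= \sum_W #|tangent_family r V W|)%N.
  rewrite -sum_nat_const.
  apply: (@leq_trans (\sum_(om in B) #|[set W | om \in tangent_family r V W]|)).
    apply: leq_sum => om; rewrite inE => /andP[_ /forallP sing_om].
    apply: (@leq_trans #|family (fun j => mem (tangent om r (V j)))|).
      rewrite card_family foldrE big_map big_enum /= -[s in leqLHS]card_ord -prod_nat_const.
      by apply: leq_prod => j _; have /andP[] := sing_om j.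
    apply: subset_leq_card; apply/subsetP => W /familyP W_tangent; rewrite !inE.
    by apply/forallP => j; have /andP[-> _] := sing_om j; exact: W_tangent.
  rewrite (double_counting (mem B) predT (fun om W => om \in tangent_family r V W)).
  by apply: leq_sum => W _; apply: subset_leq_card; apply/subsetP => om; rewrite inE => /andP[].
rewrite -(leq_pmul2r (expn_card_gt0 (0 : U) (#|Pv| * s))).
apply: (@leq_trans (\sum_W #|tangent_family r V W| * #|F| ^ (#|Pv| * #|E| * s) *
    #|{: U}| ^ (#|Pv| * s))).
  by rewrite -!big_distrl !leq_mul2r le_B !orbT.
apply: leq_trans (leq_sum _ (fun W _ => card_tangent_family_le W points_inj)) _.
rewrite -big_distrr /= [leqLHS]mulnC [leqRHS]mulnAC leq_mul2r; apply/orP; right.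
pose weight (x : U) := if x == 0 then #|{: U}| else 1%N.
rewrite -(bigA_distr_bigA (fun j (u : {ffun Pv -> U}) => \prod_i weight (u i))%N).
have -> : (2 ^ (#|Pv| * s) * #|{: U}| ^ (#|Pv| * s) =
    \prod_(j < s) \prod_(i : Pv) (2 * #|{: U}|))%N.
  by rewrite !prod_nat_const card_ord -expnM -expnMn.
apply: leq_prod => j _; rewrite -(bigA_distr_bigA (fun i (x : U) => weight x)).
apply: leq_prod => i _; rewrite (bigD1 (0 : U)) // /weight eqxx mul2n -addnn leq_add2l.
rewrite (eq_bigr (fun=> 1%N)) => [|x /negPf -> //].
by rewrite sum1_card max_card.
Qed.

Lemma sum_singular_families_le :
  ((\sum_om #|[set p | singular_family om p.1 p.2]|) * #|F| ^ s <=
    2 ^ (#|Pv| * s) * #|F| ^ (#|E| * #|Rt|) * #|{: Om}|)%N.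
Proof.
rewrite -(leq_pmul2r (expn_card_gt0 (0 : F) (#|Pv| * #|E| * s))).
rewrite (double_counting predT predT (fun om p => singular_family om p.1 p.2)).
rewrite !big_distrl /=.
apply: leq_trans (leq_sum _ (fun p _ => card_singular_family_le p.1 p.2)) _.
have card_roots : #|{: {ffun Rt -> U}}| = (#|F| ^ (#|E| * #|Rt|))%N.
  by rewrite !card_ffun expnM.
have card_families : #|{: {ffun 'I_s -> {ffun Pv -> U}}}| = (#|F| ^ (#|Pv| * #|E| * s))%N.
  by rewrite !card_ffun card_ord !expnM (expnAC _ #|E|).
rewrite sum_nat_const card_prod card_roots card_families; apply/eq_leq.
by rewrite mulnACA -[RHS]mulnA; congr (_ * _)%N; exact: mulnC.
Qed.

Lemma card_host_edge x y :
  (#|[set om | host_edge om x y]| * #|F| ^ #|Pv| = #|{: Om}|)%N.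
Proof.
pose C := [set c : coefs | (poly_of c).@[join x y] == 0].
have -> : #|[set om | host_edge om x y]| = (#|C| ^ #|Pv|)%N.
  rewrite -card_ffun_on; apply: eq_card => om; rewrite inE.
  by apply/forallP/ffun_onP => om0 h; have := om0 h; rewrite inE.
by rewrite -expnMn card_vanishing // [RHS]card_ffun.
Qed.

Definition host_edges om : {set U * U} := [set p | host_edge om p.1 p.2].

Lemma sum_card_host_edges :
  ((\sum_om #|host_edges om|) * #|F| ^ #|Pv| = #|{: U}| ^ 2 * #|{: Om}|)%N.
Proof.
rewrite (double_counting predT predT (fun om p => host_edge om p.1 p.2)) big_distrl /=.
rewrite (eq_bigr (fun=> #|{: Om}|)) => [|p _]; last exact: card_host_edge.
by rewrite sum_nat_const card_prod mulnn.
Qed.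

Local Notation singular_count om := #|[set p | singular_family om p.1 p.2]|.

Definition dense om : bool := (#|{: U}| ^ 2 <= 2 * #|host_edges om| * #|F| ^ #|Pv|)%N.

Lemma card_lt_sum_singular_count :
  (forall om, dense om -> (0 < singular_count om)%N) ->
  (#|{: Om}| < 2 * #|F| ^ #|Pv| * \sum_om singular_count om)%N.
Proof.
move=> dense_sing; pose N := (#|{: U}| ^ 2)%N.
have N0 : (0 < N)%N by exact: expn_card_gt0 (0 : U) 2.
have Om0 : (0 < #|{: Om}|)%N by apply/card_gt0P; exists 0.
have edges_lt om : (2 * #|host_edges om| * #|F| ^ #|Pv| <
    N + N * (2 * #|F| ^ #|Pv| * singular_count om))%N.
  have [/dense_sing sing_gt0|] := boolP (dense om); last by rewrite -ltnNge; exact: ltn_addr.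
  have le_N : (#|host_edges om| <= N)%N by rewrite /N -mulnn -card_prod max_card.
  rewrite -[ltnLHS]add0n -addSn leq_add //; apply: (@leq_trans (2 * N * #|F| ^ #|Pv|)).
    by rewrite leq_mul2r leq_mul2l le_N !orbT.
  by rewrite mulnAC mulnC leq_mul2l leq_pmulr ?orbT.
have sum_edges : (\sum_om (2 * #|host_edges om| * #|F| ^ #|Pv|).+1 =
    2 * (N * #|{: Om}|) + #|{: Om}|)%N.
  under eq_bigr do rewrite -addn1 -mulnA.
  by rewrite big_split /= -big_distrr -big_distrl /= sum_card_host_edges sum_nat_const muln1.
have : (\sum_om (2 * #|host_edges om| * #|F| ^ #|Pv|).+1 <=
    \sum_om (N + N * (2 * #|F| ^ #|Pv| * singular_count om)))%N.
  by apply: leq_sum => om _; exact: edges_lt.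
rewrite sum_edges big_split sum_nat_const -!big_distrr /= -(ltn_pmul2l N0).
by rewrite -[#|xpredT|]/#|{: Om}|; lia.
Qed.

Lemma exists_dense_nonsingular :
  (2 * 2 ^ (#|Pv| * s) * #|F| ^ (#|E| * #|Rt| + #|Pv|) <= #|F| ^ s)%N ->
  exists2 om, (forall r V, ~~ singular_family om r V) & dense om.
Proof.
move=> large_q; suff /exists_inP[om dense_om /eqP sing0] :
    [exists om in dense, singular_count om == 0%N].
  exists om => // r V; apply: contraT => /negPn sing_rV.
  by have := card0_eq sing0 (r, V); rewrite inE sing_rV.
apply: contraT; rewrite negb_exists_in => /forall_inP no_om.
have /card_lt_sum_singular_count : forall om, dense om -> (0 < singular_count om)%N.
  by move=> om /no_om; rewrite lt0n.
rewrite ltnNge => /negP[]; rewrite -(leq_pmul2r (expn_card_gt0 (0 : F) s)) -mulnA.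
apply: leq_trans (leq_mul (leqnn _) sum_singular_families_le) _.
rewrite mulnA [leqRHS]mulnC leq_mul2r; apply/orP; right; apply: leq_trans large_q.
by rewrite expnD; apply/eq_leq; lia.
Qed.
End Singular.

Lemma oriented_copies_lt s om r l (v : 'I_l -> {ffun Pv -> U}) : (0 < #|E|)%N ->
  (forall V, ~~ @singular_family s om r V) -> (forall j, hosted om r (v j)) ->
  injective (fun p : 'I_l * E => edge_point r (v p.1) p.2) ->
  (l < zero_bound #|{: Pv * E}| d + s)%N.
Proof.
move=> /card_gt0P[e0 _] no_sing v_hosted points_inj; rewrite ltnNge; apply/negP => le_l.
pose sing := [set j | (#|F| <= #|tangent om r (v j)|)%N].
have v_inj : injective v.
  move=> j j' eq_v.
  by have [] := points_inj (j, e0) (j', e0) (congr1 (fun u => edge_point r u e0) eq_v).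
have le_s : (s <= #|sing|)%N.
  rewrite -(leq_add2l #|~: sing|) [leqRHS]addnC cardsC card_ord; apply: leq_trans le_l.
  rewrite leq_add2r; apply: leq_trans (card_nonsingular_copies om r).
  rewrite -(card_imset _ v_inj); apply: subset_leq_card; apply/subsetP => _ /imsetP[j + ->].
  by rewrite !inE -ltnNge v_hosted.
pose V : {ffun 'I_s -> {ffun Pv -> U}} := [ffun i => v (enum_val (widen_ord le_s i))].
have /negP := no_sing V; apply; apply/andP; split.
  apply/injectiveP => -[i e] [i' e']; rewrite !ffunE /= => eq_points.
  have [/enum_val_inj eq_i ->] := points_inj (_, e) (_, e') eq_points.
  by congr (_, _); apply/val_inj; have := congr1 val eq_i.
apply/forallP => i; rewrite ffunE v_hosted /=.
by have := enum_valP (widen_ord le_s i); rewrite inE.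
Qed.
End AlgebraicGraph.

(** * The rooted path in an algebraic graph *)

Definition bipartite_rel (T U : finType) (R : T -> U -> bool) : rel (T + U) := fun a b =>
  match a, b with inl x, inr y | inr y, inl x => R x y | _, _ => false end.

Definition in_left (T U : Type) (a : T + U) : bool := if a is inl _ then true else false.

Lemma bipartite_rel_flip (T U : finType) (R : T -> U -> bool) a b :
  bipartite_rel R a b -> in_left b = ~~ in_left a.
Proof. by case: a b => [x|x] [y|y]. Qed.

(* Edges are the legs and the spine of the comb; the first vertex class consists of the even
   roots and the odd path vertices. *)
Definition comb_edge : finType := ('I_4 + 'I_3)%type.

Definition spine_start (i : 'I_3) : 'I_4 := widen_ord (leqnSn 3) i.

Definition spine_end (i : 'I_3) : 'I_4 := lift ord0 i.

Definition comb_xs (e : comb_edge) : 'I_4 + 'I_4 :=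
  match e with
  | inl i => if odd i then inr i else inl i
  | inr i => inr (if odd i then spine_start i else spine_end i)
  end.

Definition comb_ys (e : comb_edge) : 'I_4 + 'I_4 :=
  match e with
  | inl i => if odd i then inl i else inr i
  | inr i => inr (if odd i then spine_end i else spine_start i)
  end.

Lemma comb_balanced : balanced comb_xs comb_ys.
Proof.
move=> S; rewrite card_sum !card_ord.
have -> : #|S| = (\sum_(i < 4) (i \in S))%N by rewrite -sum1_card big_mkcond.
have -> : #|[set e | touches comb_xs comb_ys S e]| =
    (\sum_(i < 4) (i \in S) + \sum_(i < 3) ((spine_start i \in S) || (spine_end i \in S)))%N.
  rewrite -sum1_card big_mkcond big_sumType /=; congr (_ + _)%N; apply: eq_bigr => i _.
    by rewrite inE /touches /=; case: (odd i); rewrite ?orbF; case: (i \in S).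
  by rewrite inE /touches /=; case: (odd i); rewrite 1?orbC; case: (_ || _).
rewrite !big_ord_recl !big_ord0 /spine_end.
have start0 : spine_start ord0 = ord0 by apply: val_inj.
have start1 : spine_start (lift ord0 ord0) = lift ord0 ord0 by apply: val_inj.
have start2 : spine_start (lift ord0 (lift ord0 ord0)) = lift ord0 (lift ord0 ord0).
  exact: val_inj.
rewrite start0 start1 start2.
by do 4!case: (_ \in S).
Qed.

Section CombInHost.
Variables (F : finFieldType) (d s : nat).
Local Notation U := {ffun comb_edge -> F}.
Variable om : {ffun 'I_4 -> 'rV[F]_#|{: 'X_{1..#|{: comb_edge + comb_edge}| < d.+1}}|}.
Hypothesis om_nonsingular :
  forall r (V : {ffun 'I_s -> _}), ~~ singular_family comb_xs comb_ys om r V.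
Local Notation host := (bipartite_rel (host_edge om)).

Definition copy_vertex l (j : 'I_l) (sl : 'I_4 + 'I_4) : Tblowup_V l :=
  match sl with inl i => inl i | inr i => inr (j, i) end.

Lemma Tblowup_comb_edge l (j : 'I_l) e :
  Tblowup (copy_vertex j (comb_xs e)) (copy_vertex j (comb_ys e)).
Proof.
by case: e => i /=; case: (odd i); rewrite /= ?eqxx ?add0n ?orbT.
Qed.

Lemma comb_edge_inj l (j j' : 'I_l) e e' :
  copy_vertex j (comb_xs e) = copy_vertex j' (comb_xs e') ->
  copy_vertex j (comb_ys e) = copy_vertex j' (comb_ys e') -> (j, e) = (j', e').
Proof.
case: e e' => i [] i' /=; case: (boolP (odd i)) => odd_i; case: (boolP (odd i')) => odd_i' //= [].
- by move=> -> ->.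
- by move=> -> [->].
- by move=> -> /val_inj->.
- by move=> _ eq_x [_]; move: eq_x; rewrite /bump; lia.
- by move=> _ eq_x [_]; move: eq_x; rewrite /bump; lia.
- by move=> ->; rewrite !add0n => /val_inj->.
Qed.

Lemma in_left_comb l (w : Tblowup_V l -> U + U) (j : 'I_l) :
  {homo w : t t' / Tblowup t t' >-> host t t'} ->
  (forall i, in_left (w (inr (j, i))) = in_left (w (inl ord0)) (+) ~~ odd i) /\
  (forall i, in_left (w (inl i)) = in_left (w (inl ord0)) (+) odd i).
Proof.
move=> w_hom; have flip t t' (Gtt' : Tblowup t t') := bipartite_rel_flip (w_hom t t' Gtt').
have left_path i : in_left (w (inr (j, i))) = in_left (w (inl ord0)) (+) ~~ odd i.
  case: i => i; elim: i => [|i IHi] lt_i4.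
    by rewrite (flip (inl ord0)) ?addbT // (_ : Ordinal lt_i4 = ord0) //; apply: val_inj.
  by rewrite (flip (inr (j, Ordinal (ltnW lt_i4)))) /= ?IHi ?eqxx //= !addbN.
split=> // i; rewrite (flip (inr (j, i))) ?left_path ?addbN ?negbK //.
by rewrite /= eqxx.
Qed.

Lemma left_rooted_lt l (w : Tblowup_V l -> U + U) : injective w ->
  {homo w : t t' / Tblowup t t' >-> host t t'} -> in_left (w (inl ord0)) ->
  (l < zero_bound #|{: 'I_4 * comb_edge}| d + s)%N.
Proof.
move=> w_inj w_hom left0; pose point (a : U + U) := match a with inl x | inr x => x end.
pose r : {ffun 'I_4 -> U} := [ffun i => point (w (inl i))].
pose v (j : 'I_l) : {ffun 'I_4 -> U} := [ffun i => point (w (inr (j, i)))].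
have at_vertex j sl : at_slot r (v j) sl = point (w (copy_vertex j sl)).
  by case: sl => i; rewrite /at_slot ffunE.
have sides j e : in_left (w (copy_vertex j (comb_xs e))) /\
    ~~ in_left (w (copy_vertex j (comb_ys e))).
  have [left_path left_root] := in_left_comb j w_hom.
  have odd_end i : odd (spine_end i) = ~~ odd i by [].
  rewrite left0 in left_path left_root; case: e => i /=.
    by case: ifP => odd_i; rewrite ?left_path ?left_root odd_i.
  by case: ifP => odd_i; rewrite !left_path odd_end /= odd_i.
have wx j e : w (copy_vertex j (comb_xs e)) = inl (at_slot r (v j) (comb_xs e)).
  by rewrite at_vertex; have [+ _] := sides j e; case: (w _).
have wy j e : w (copy_vertex j (comb_ys e)) = inr (at_slot r (v j) (comb_ys e)).
  by rewrite at_vertex; have [_] := sides j e; case: (w _).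
apply: (oriented_copies_lt (xs := comb_xs) (ys := comb_ys) (om := om) (r := r) (v := v)).
- by rewrite card_sum !card_ord.
- exact: om_nonsingular.
- by move=> j; apply/forallP => e; have := w_hom _ _ (Tblowup_comb_edge j e); rewrite wx wy.
- move=> [j e] [j' e'] /= /join_inj[eq_x eq_y].
  by apply: comb_edge_inj; apply: w_inj; rewrite ?wx ?wy ?eq_x ?eq_y.
Qed.

Definition reverse_comb l (t : Tblowup_V l) : Tblowup_V l :=
  match t with inl i => inl (rev_ord i) | inr (j, i) => inr (j, rev_ord i) end.

Lemma reverse_combK l : involutive (@reverse_comb l).
Proof. by case=> [i|[j i]] /=; rewrite rev_ordK. Qed.

Lemma reverse_comb_hom l : {homo @reverse_comb l : t t' / Tblowup t t' >-> Tblowup t t'}.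
Proof.
case=> [i|[j i]] [i'|[j' i']] //=; rewrite ?(inj_eq rev_ord_inj) // => /andP[-> /=].
by have := ltn_ord i; have := ltn_ord i'; lia.
Qed.

Lemma host_blowup_free l : (zero_bound #|{: 'I_4 * comb_edge}| d + s <= l)%N -> (0 < l)%N ->
  ~ embeds (@Tblowup l) host.
Proof.
move=> le_l l0 [w w_inj w_hom].
have [left0|right0] := boolP (in_left (w (inl ord0))).
  by have := left_rooted_lt w_inj w_hom left0; rewrite ltnNge le_l.
suff : (l < zero_bound #|{: 'I_4 * comb_edge}| d + s)%N by rewrite ltnNge le_l.
apply: (left_rooted_lt (w := w \o @reverse_comb l)) => [||/=].
- exact: inj_comp w_inj (inv_inj (@reverse_combK l)).
- by move=> t t' /reverse_comb_hom/w_hom.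
- by have [_ ->] := in_left_comb (Ordinal l0) w_hom; rewrite (negPf right0).
Qed.
End CombInHost.

Local Open Scope nat_scope.

(** * The extremal number *)

(* q := 2 ^ k for the largest k with 2 * (2 ^ b) ^ k <= n. *)
Lemma exists_finField_card_between b q0 : 0 < b -> exists N, forall n, N <= n ->
  exists F : finFieldType, [/\ q0 <= #|F|, 2 * #|F| ^ b <= n & n <= 2 * 2 ^ b * #|F| ^ b].
Proof.
move=> b0; pose c := 2 ^ b; have c1 : 1 < c by rewrite -[1]/(2 ^ 0) ltn_exp2l.
exists (2 * c ^ q0.+1) => n le_n; pose k := trunc_log c (n %/ 2).
have le_n2 : c ^ q0.+1 <= n %/ 2 by rewrite leq_divRL // mulnC.
have n2_gt0 : 0 < n %/ 2 by apply: leq_trans le_n2; rewrite expn_gt0 ltnW.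
have /andP[k_lo k_hi] := trunc_log_bounds c1 n2_gt0.
have lt_q0k : q0 < k by rewrite -(trunc_expnK q0.+1 c1); exact: leq_trunc_log.
have [F _ cardF] := PrimePowerField (isT : prime 2) (leq_ltn_trans (leq0n q0) lt_q0k).
have cardFb : #|F| ^ b = c ^ k by rewrite cardF -!expnM mulnC.
exists F; split.
- by rewrite cardF (leq_trans (ltnW lt_q0k)) // ltnW // ltn_expl.
- by rewrite cardFb (leq_trans _ (leq_divM n 2)) // mulnC leq_mul2r k_lo.
rewrite cardFb -mulnA -expnS (leq_trans (ltnW (ltn_ceil n (isT : 0 < 2)))) //.
by rewrite mulnC leq_mul2l.
Qed.

Lemma large_field_bound a s c q : 2 * 2 ^ (a * s) <= q -> c < s ->
  2 * 2 ^ (a * s) * q ^ c <= q ^ s.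
Proof.
move=> le_q lt_cs; have q0 : 0 < q by apply: leq_trans le_q; rewrite muln_gt0 expn_gt0.
apply: (@leq_trans (q ^ c.+1)); last by rewrite leq_pexp2l.
by rewrite expnS leq_mul2r le_q orbT.
Qed.

Lemma leq_expn_trans a b C c n q e : 0 < a -> 0 < b ->
  n <= C * q ^ b -> q ^ a <= c * e -> n ^ a <= C ^ a * c ^ b * e ^ b.
Proof.
move=> a0 b0 le_n le_q; rewrite -mulnA -expnMn; apply: (@leq_trans ((C * q ^ b) ^ a)).
  by rewrite leq_exp2r.
by rewrite expnMn expnAC leq_mul2l leq_exp2r ?le_q ?orbT.
Qed.

Lemma ex_Tblowup_ge_host_edges (F : finFieldType) d s l n
    (om : {ffun 'I_4 -> 'rV[F]_#|{: 'X_{1..#|{: comb_edge + comb_edge}| < d.+1}}|}) :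
  (forall r (V : {ffun 'I_s -> _}), ~~ singular_family comb_xs comb_ys om r V) ->
  zero_bound #|{: 'I_4 * comb_edge}| d + s <= l ->
  0 < l -> 2 * #|F| ^ 7 <= n -> #|host_edges om| <= @ex n _ (@Tblowup l).
Proof.
move=> om_nonsingular le_l l0 le_n.
have not_embeds := host_blowup_free om_nonsingular le_l l0.
pose U : finType := {ffun comb_edge -> F}.
pose f (p : U * U) : (U + U) * (U + U) := (inl p.1, inr p.2).
have f_inj : injective f by move=> [x y] [x' y'] [-> ->].
rewrite -(card_imset _ f_inj); apply: leq_card_ex not_embeds _ => //.
- by case=> [x|x] [y|y].
- by case.
- by rewrite card_sum card_ffun card_sum !card_ord addnn -mul2n.
- case=> [i|[j i]]; last by exists (inl i); rewrite /= eqxx.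
  by exists (inr (Ordinal l0, i)); rewrite /= eqxx.
move=> a b /imsetP[[x y] xyP [-> ->]]; rewrite inE /= in xyP *.
by rewrite xyP; apply/imsetP => -[[x' y']].
Qed.

Theorem ex_Tblowup_pow_ge : exists l0, forall l, l0 < l ->
  exists K N, forall n, N <= n -> n ^ 10 <= K * @ex n _ (@Tblowup l) ^ 7.
Proof.
have [s lt_s] : exists s, 7 * 4 + 4 < s by exists 33.
pose d := (2 * (s * #|comb_edge|)).+1.
exists (zero_bound #|{: 'I_4 * comb_edge}| d + s) => l lt_l.
have [N large_field] := exists_finField_card_between (2 * 2 ^ (4 * s)) (isT : 0 < 7).
exists ((2 * 2 ^ 7) ^ 10 * 2 ^ 7), N => n /large_field[F [le_q le_n le_nC]].
have cardE : #|{: comb_edge}| = 7 by rewrite card_sum !card_ord.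
have [|||om om_nonsingular dense_om] := @exists_dense_nonsingular _ _ _ comb_xs comb_ys F d s.
- exact: leqnn.
- exact: comb_balanced.
- by rewrite cardE !card_ord; exact: large_field_bound.
have := ex_Tblowup_ge_host_edges om_nonsingular (ltnW lt_l) (leq_ltn_trans (leq0n _) lt_l) le_n.
set e := @ex n _ _; set q := #|F| in le_n le_nC le_q dense_om * => le_edges.
apply: leq_expn_trans le_nC _ => //.
have q4 : 0 < q ^ 4 by rewrite expn_gt0 (leq_trans _ le_q) // muln_gt0 expn_gt0.
rewrite -(leq_pmul2r q4) -expnD; move: dense_om; rewrite /dense card_ffun cardE card_ord -expnM.
by move/leq_trans; apply; rewrite leq_mul2r leq_mul2l le_edges !orbT.
Qed.

(** * Real exponents *)

Section RealExponents.
Local Open Scope R_scope.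

Lemma INR_expn m n : INR (m ^ n)%N = INR m ^ n.
Proof. by elim: n => [|n IHn] //=; rewrite expnS -multE mult_INR IHn. Qed.

Lemma leq_INR m n : (m <= n)%N -> INR m <= INR n.
Proof. by move=> le_mn; apply: le_INR; exact/leP. Qed.

Lemma Rle_of_pow_le n K x y : (0 < n)%N -> 0 <= K -> 0 <= y ->
  x ^ n <= K * y ^ n -> x <= (K + 1) * y.
Proof.
move=> n0 K0 y0 le_pow; apply: Rnot_lt_le => lt_x.
have Ky0 : 0 <= (K + 1) * y by apply: Rmult_le_pos => //; lra.
have x_pow : ((K + 1) * y) ^ n <= x ^ n by apply: pow_incr; lra.
have le_K : K + 1 <= (K + 1) ^ n.
  by rewrite -{1}[K + 1]pow_1; apply: Rle_pow; [lra | exact/leP].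
have [y_gt0|y_eq0] := Rle_lt_or_eq_dec 0 y y0.
  have yn0 : 0 < y ^ n by exact: pow_lt.
  by rewrite Rpow_mult_distr in x_pow; nra.
rewrite -y_eq0 Rmult_0_r in lt_x; rewrite -y_eq0 pow_ne_zero in le_pow; last by case: (n) n0.
by have := pow_lt x n lt_x; lra.
Qed.

Lemma Rpower_div_pow x a b : 0 < x -> (0 < b)%N -> Rpower x (INR a / INR b) ^ b = x ^ a.
Proof.
move=> x0 b0; have b_neq0 : INR b <> 0 by apply: not_0_INR; case: (b) b0.
rewrite -!Rpower_pow ?Rpower_mult //; last exact: exp_pos.
by rewrite /Rdiv Rmult_assoc Rinv_l ?Rmult_1_r.
Qed.

Lemma Theta_Rpower (f : nat -> nat) a b K C N : (0 < b)%N ->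
  (forall n, (N <= n)%N -> (n ^ a <= K * f n ^ b)%N) ->
  (forall n, (f n ^ b <= C * n ^ a)%N) ->
  exists c1 c2, 0 < c1 /\ 0 < c2 /\ exists N0, forall n, (n >= N0)%coq_nat ->
    c1 * Rpower (INR n) (INR a / INR b) <= INR (f n) /\
    INR (f n) <= c2 * Rpower (INR n) (INR a / INR b).
Proof.
move=> b0 lower upper; have [K0 C0] := conj (pos_INR K) (pos_INR C).
exists (/ (INR K + 1)), (INR C + 1); split; first by apply: Rinv_0_lt_compat; lra.
split; first by lra.
exists N.+1 => n /leP lt_Nn; set y := Rpower _ _.
have y0 : 0 < y by exact: exp_pos.
have y_pow : y ^ b = INR n ^ a.
  by apply: Rpower_div_pow => //; apply: lt_0_INR; apply/ltP; exact: leq_ltn_trans lt_Nn.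
split; last first.
  apply: (Rle_of_pow_le b0) => //; first lra.
  by rewrite y_pow -!INR_expn -mult_INR; apply: leq_INR; exact: upper.
have le_y : y <= (INR K + 1) * INR (f n).
  apply: (Rle_of_pow_le b0) => //; first exact: pos_INR.
  by rewrite y_pow -!INR_expn -mult_INR; apply: leq_INR; exact: lower (ltnW lt_Nn).
apply: (Rmult_le_reg_l (INR K + 1)); first by lra.
by rewrite -Rmult_assoc Rinv_r ?Rmult_1_l //; lra.
Qed.
End RealExponents.

End CombBlowup.

Open Scope R_scope.

Theorem theorem5p1 :
  exists l0 : nat, forall l : nat, (l > l0)%nat ->
    exists c1 c2 : R, 0 < c1 /\ 0 < c2 /\
    exists N : nat, forall n : nat, (n >= N)%nat ->
      c1 * Rpower (INR n) (10 / 7) <= INR (@ex n (Tblowup_V l) (@Tblowup l)) /\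
      INR (@ex n (Tblowup_V l) (@Tblowup l)) <= c2 * Rpower (INR n) (10 / 7).
Proof.
have [l0 lower] := CombBlowup.ex_Tblowup_pow_ge.
exists l0 => l /ssrnat.ltP/lower[K [N ge_pow]].
have [C le_pow] := CombBlowup.ex_Tblowup_pow_le l.
have -> : 10 / 7 = INR 10 / INR 7 by rewrite /=; lra.
exact: (CombBlowup.Theta_Rpower (isT : is_true (ssrnat.leq 1 7)) ge_pow le_pow).
Qed.
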